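(* There is a universal constant $C>0$ such that the following holds in the setting described in the context. Fix $t\in\mathbb{Z}_+$, $\delta\in(0,1)$ and $f_1,f_2\in\mathcal{F}$, and run the Adaptive Rolling Window model comparison procedure with $\delta'=\delta/(3t)$ and $M=2(b-a)$. With probability at least $1-\delta$, its output $\widehat f$ satisfies $$L_t(\widehat f)-\min_{r\in\{1,2\}}L_t(f_r)\le C\log(6t/\delta)\min_{k\in[t]}\left\{\max_{t-k+1\le j\le t}|\Delta_j-\Delta_t|+\frac{\widetilde\sigma_{t,k}}{\sqrt{B_{t,k}}}+\frac{b-a}{B_{t,k}}\right\},$$ where $\Delta_j=L_j(f_1)-L_j(f_2)$ and $\widetilde\sigma_{t,k}^2=\frac{1}{B_{t,k}}\sum_{j=t-k+1}^tB_j\operatorname{Var}_{z\sim\mathcal{P}_j}[\ell(f_1,z)-\ell(f_2,z)]$.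
   Context: Let $\mathcal{Z}$ be a sample space, $\mathcal{F}$ a set of models, and $\ell:\mathcal{F}\times\mathcal{Z}\to[a,b]$ (with $a<b$) a measurable loss. For $j\in\mathbb{Z}_+$, $\mathcal{P}_j$ is a probability distribution on $\mathcal{Z}$ and $L_j(f)=\mathbb{E}_{z\sim\mathcal{P}_j}\ell(f,z)$. For $j\in[t]$ the batch $\{z_{j,i}\}_{i=1}^{B_j}$ ($B_j\ge1$) consists of i.i.d. samples from $\mathcal{P}_j$, and batches are independent across $j$. Let $B_{t,k}=\sum_{j=t-k+1}^tB_j$. Adaptive Rolling Window (mean estimation) with hyperparameters $\delta'\in(0,1)$, $M>0$, applied to real data $\{u_{j,i}\}_{j\in[t],i\in[B_j]}$: for $k\in[t]$ let $\widehat\mu_{t,k}=\frac{1}{B_{t,k}}\sum_{j=t-k+1}^t\sum_{i=1}^{B_j}u_{j,i}$; when $B_{t,k}\ge2$, $\widehat v_{t,k}^2=\frac{1}{B_{t,k}-1}\sum_{j=t-k+1}^t\sum_{i=1}^{B_j}(u_{j,i}-\widehat\mu_{t,k})^2$ with $\widehat v_{t,k}\ge0$; $\widehat\psi(t,k,\delta')=M$ if $B_{t,k}=1$ and $\widehat\psi(t,k,\delta')=\widehat v_{t,k}\sqrt{2\log(2/\delta')/B_{t,k}}+\frac{8M\log(2/\delta')}{3(B_{t,k}-1)}$ if $B_{t,k}\ge2$; $\widehat\phi(t,k,\delta')=\max_{i\in[k]}\big(|\widehat\mu_{t,k}-\widehat\mu_{t,i}|-[\widehat\psi(t,k,\delta')+\widehat\psi(t,i,\delta')]\big)_+$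 with $x_+=\max\{x,0\}$; choose any $\widehat k\in\mathop{\mathrm{argmin}}_{k\in[t]}\{\widehat\phi(t,k,\delta')+\widehat\psi(t,k,\delta')\}$ and output $\widehat\mu_{t,\widehat k}$. Adaptive Rolling Window model comparison with hyperparameters $\delta',M$: set $u_{j,i}=\ell(f_1,z_{j,i})-\ell(f_2,z_{j,i})$, run the mean-estimation procedure above on these data with $\delta',M$ to obtain $\widehat\Delta_{t,\widehat k}$, and output $\widehat f=f_1$ if $\widehat\Delta_{t,\widehat k}\le 0$ and $\widehat f=f_2$ otherwise. *)

(* Defs.v *)
From HB Require Import structures.
From mathcomp Require Import all_boot all_order all_algebra.
From mathcomp Require Import all_classical all_reals all_analysis.
Set Implicit Arguments. Unset Strict Implicit. Unset Printing Implicit Defensive.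
Import Order.TTheory GRing.Theory Num.Theory.
Import numFieldNormedType.Exports.
Local Open Scope classical_set_scope.
Local Open Scope ring_scope.

Section ARW.
Variable R : realType.

(* Indices: time periods j are naturals 1..t; within batch j the samples are
   indexed by i = 0 .. B j - 1 (i.e. the paper's i = 1..B_j shifted by one). *)

Definition Bsum (B : nat -> nat) (t k : nat) : nat :=
  (\sum_(t - k + 1 <= j < t.+1) B j)%N.

Definition mu_hat (B : nat -> nat) (u : nat -> nat -> R) (t k : nat) : R :=
  (Bsum B t k)%:R^-1 * \sum_(t - k + 1 <= j < t.+1) \sum_(i < B j) u j i.

Definition v_hat (B : nat -> nat) (u : nat -> nat -> R) (t k : nat) : R :=
  Num.sqrt ((Bsum B t k - 1)%:R^-1 *
    \sum_(t - k + 1 <= j < t.+1) \sum_(i < B j) (u j i - mu_hat B u t k) ^+ 2).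

Definition psi_hat (B : nat -> nat) (u : nat -> nat -> R) (M delta' : R)
  (t k : nat) : R :=
  if Bsum B t k == 1%N then M
  else v_hat B u t k * Num.sqrt (2 * ln (2 / delta') / (Bsum B t k)%:R)
       + 8 * M * ln (2 / delta') / (3 * (Bsum B t k - 1)%:R).

Definition phi_hat (B : nat -> nat) (u : nat -> nat -> R) (M delta' : R)
  (t k : nat) : R :=
  \big[Num.max/0]_(1 <= i < k.+1)
     Num.max (`|mu_hat B u t k - mu_hat B u t i|
              - (psi_hat B u M delta' t k + psi_hat B u M delta' t i)) 0.

Definition is_khat (B : nat -> nat) (u : nat -> nat -> R) (M delta' : R)
  (t k : nat) : Prop :=
  (1 <= k <= t)%N /\
  forall k', (1 <= k' <= t)%N ->
    phi_hat B u M delta' t k + psi_hat B u M delta' t k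
    <= phi_hat B u M delta' t k' + psi_hat B u M delta' t k'.

Definition arw_choose_f1 (B : nat -> nat) (u : nat -> nat -> R) (t khat : nat)
  : bool := mu_hat B u t khat <= 0.

Definition min_range (X : nat -> R) (t : nat) : R :=
  \big[Num.min/X 1%N]_(1 <= k < t.+1) X k.

(* maximum over t-k+1 <= j <= t of a nonnegative quantity *)
Definition max_window (X : nat -> R) (t k : nat) : R :=
  \big[Num.max/0]_(t - k + 1 <= j < t.+1) X j.

End ARW.

Definition sample_index (B : nat -> nat) (t : nat) : seq (nat * nat) :=
  [seq (j, i) | j <- iota 1 t, i <- iota 0 (B j)].

Definition mutually_independent {dO dZ} {Omega : measurableType dO}
  {Z : measurableType dZ} {R : realType} (P : probability Omega R)
  (z : nat -> nat -> Omega -> Z) (idx : seq (nat * nat)) : Prop :=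
  forall A : nat -> nat -> set Z,
    (forall p, p \in idx -> measurable (A p.1 p.2)) ->
    P (\big[setI/setT]_(p <- idx) (z p.1 p.2 @^-1` A p.1 p.2))
    = (\prod_(p <- idx) P (z p.1 p.2 @^-1` A p.1 p.2))%E.

Definition Ldist {dZ} {Z : measurableType dZ} {R : realType}
  (Q : probability Z R) (g : Z -> R) : R := (\int[Q]_(x in setT) g x)%R.

Definition Vardist {dZ} {Z : measurableType dZ} {R : realType}
  (Q : probability Z R) (g : Z -> R) : R :=
  (\int[Q]_(x in setT) (g x - Ldist Q g) ^+ 2)%R.

(* Main.v *)
(* Center every sample of a window at the average [c] of the window's (possibly different)
   means; the first-order terms then cancel and Chernoff's method behaves as in the i.i.d. case.
   This gives Bernstein bounds for the sum, a lower tail for the sum of squares about [c]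
   (through [exp (- y) <= 1 - y + y ^ 2 / 2]) and a crude upper tail.  Passing from squares
   about [c] to squares about the empirical mean costs the squared deviation itself; the cost is
   absorbed by the slack between the constant 8/3 of the radius and the Bernstein constant, once
   the range [r] of the samples about [c] is tracked and the Bhatia-Davis inequality
   [s ^ 2 <= r * (M - r)] is used.  So the empirical radius dominates every window's deviation
   with failure probability [4 exp (- L)], without a concentration theorem for the sample
   variance.  The rest is Lepski's argument for the selected window, and the excess loss is at
   most the error of the estimate of [Delta t]. *)
Require Import Defs.
From HB Require Import structures.
From mathcomp Require Import all_boot all_order all_algebra.
From mathcomp Require Import all_classical all_reals all_analysis.
From mathcomp Require Import measurable_realfun ring lra.
Import Order.TTheory GRing.Theory Num.Theory.
Import numFieldNormedType.Exports.
Local Open Scope classical_set_scope.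
Local Open Scope ring_scope.

(** * Exponential inequalities *)

Section exp_bounds.
Context {R : realType}.
Implicit Types x y z : R.

(** Each exponential bound below integrates a lower-order bound through this monotonicity criterion
    on the half line. *)
Lemma nonneg_of_derive_nonneg (f df : R -> R) :
  (forall x, is_derive x 1 f (df x)) -> (forall x, 0 <= x -> 0 <= df x) ->
  forall x, 0 <= x -> f 0 <= f x.
Proof.
move=> fd df0 x x0.
apply: (@ger0_derive1_ndecry _ f 0) => //.
- move=> y; rewrite in_itv/= andbT => /ltW y0; rewrite derive1E (@derive_val _ _ _ _ _ _ _ (fd y)); exact: df0.
- apply: continuous_subspaceT => y.
  by apply/differentiable_continuous/derivable1_diffP; case: (fd y).
Qed.

Lemma expR_ge_quad x : 0 <= x -> 1 + x + x ^+ 2 / 2 <= expR x.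
Proof.
move=> x0.
have := nonneg_of_derive_nonneg (fun y => expR y - (1 + y + y ^+ 2 / 2))
  (fun y => expR y - (1 + y)) _ _ x x0.
rewrite expR0 => H; rewrite -subr_ge0; apply: le_trans (H _ _).
- by lra.
- move=> y; apply: is_derive_eq; rewrite /GRing.scale/=; by field.
- by move=> y _; rewrite subr_ge0 expR_ge1Dx.
Qed.

Lemma expRN_le_quad x : 0 <= x -> expR (- x) <= 1 - x + x ^+ 2 / 2.
Proof.
move=> x0.
have := nonneg_of_derive_nonneg (fun y => (1 - y + y ^+ 2 / 2) - expR (- y))
  (fun y => expR (- y) - (1 - y)) _ _ x x0.
rewrite oppr0 expR0 => H; rewrite -subr_ge0; apply: le_trans (H _ _).
- by lra.
- move=> y; apply: is_derive_eq; rewrite /GRing.scale/=; by field.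
- by move=> y _; rewrite subr_ge0 expR_ge1Dx.
Qed.

(* The [2/1] Pade approximant of the exponential. *)
Lemma expR_le_pade x : 0 <= x < 3 -> expR x <= 1 + x + x ^+ 2 / (2 * (1 - x / 3)).
Proof.
move=> /andP[x0 x3].
(* Multiplied by [expR (- x)] and cleared of denominators, the claim is [6 - 2 * x <= (6 + 4 * x + x
   ^+ 2) * expR (- x)]: an equality at 0, and the difference is increasing by [expR_ge_quad]. *)
have := nonneg_of_derive_nonneg
  (fun y => (6 + 4 * y + y ^+ 2) * expR (- y) - (6 - 2 * y))
  (fun y => 2 - (2 + 2 * y + y ^+ 2) * expR (- y)) _ _ x x0.
rewrite oppr0 expR0 => H.
have {}H : 0 <= (6 + 4 * x + x ^+ 2) * expR (- x) - (6 - 2 * x).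
  apply: le_trans (H _ _).
  - by lra.
  - move=> y; apply: is_derive_eq; rewrite /GRing.scale/=; by ring.
  - move=> y y0; rewrite expRN subr_ge0 ler_pdivrMr ?expR_gt0//.
    by have := expR_ge_quad y y0; lra.
rewrite expRN subr_ge0 ler_pdivlMr ?expR_gt0// in H.
have -> : 1 + x + x ^+ 2 / (2 * (1 - x / 3)) = (6 + 4 * x + x ^+ 2) / (6 - 2 * x).
  by field; apply/andP; split; lra.
by rewrite ler_pdivlMr 1?mulrC//; lra.
Qed.

(** Only an upper bound on [z] matters: for [z >= 0] the Pade denominator decreases in its argument,
    and for [z < 0] the quadratic bound is already stronger. *)
Lemma expR_le_bernstein z r : z <= r -> 0 <= r < 3 ->
  expR z <= 1 + z + z ^+ 2 / (2 * (1 - r / 3)).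
Proof.
move=> zr /andP[r0 r3].
have [z0|z0] := leP 0 z.
  apply: le_trans (expR_le_pade z _) _; first by rewrite z0 (le_lt_trans zr).
  rewrite lerD2l ler_wpM2l ?sqr_ge0// lef_pV2 ?posrE; lra.
have := expRN_le_quad (- z); rewrite opprK sqrrN => H.
apply: le_trans (H _) _; first by lra.
rewrite lerD2l ler_wpM2l ?sqr_ge0// lef_pV2 ?posrE; lra.
Qed.

Lemma expR_le_affine z : 0 <= z <= 1 -> expR z <= 1 + 2 * z.
Proof.
move=> /andP[z0 z1].
apply: le_trans (expR_le_bernstein z 1 z1 _) _; first by lra.
have -> : 2 * (1 - 1 / 3) = 4 / 3 :> R by lra.
by rewrite invf_div; nra.
Qed.

End exp_bounds.

(** * From the Bernstein radius to the empirical radius *)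

Section empirical_bernstein_algebra.
Context {R : realType}.
(* [x]: deviation of the empirical mean; [s], [v]: true and empirical standard deviations;
   [r]: range of the samples about the mean; [M]: total range; [e ^ 2 = 2 L / n]. *)
Lemma empirical_bernstein_algebra (M r e x s v : R) :
  0 < r -> r <= M -> 0 < e -> 0 <= s -> 0 <= v -> 0 <= x ->
  s ^+ 2 <= r * (M - r) ->
  x <= e * s + r * e ^+ 2 / 4 ->
  s ^+ 2 - r * e * s <= v ^+ 2 + x ^+ 2 ->
  x <= e * v + 4 / 3 * M * e ^+ 2.
Proof.
move=> r0 rM e0 s0 v0 x0 sv xs sx.
(* [g] is the slack between the empirical constant and the Bernstein one; it suffices that
   [s <= v + g * e]. *)
pose g := 4 / 3 * M - r / 4.
have [sg|gs] := leP s (g * e).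
  apply: (le_trans xs).
  have : e * s <= e * (g * e) by rewrite ler_wpM2l// ltW.
  have : 0 <= e * v by rewrite mulr_ge0// ltW.
  by rewrite /g; lra.
have M0 : 0 < M by lra.
have g0 : 13 / 12 * M <= g by rewrite /g; lra.
have gp : 0 < g by lra.
have gr : 0 < g - r by rewrite /g; lra.
(* This inequality contradicts a failure of [s - g * e <= v]; it follows from Bhatia-Davis and from
   [g >= 13 / 12 * M], that is [r <= M]. *)
have key : 16 / 9 * M ^+ 2 * s ^+ 2 <= g ^+ 3 * (g - r).
  have g2 : (13 / 12) ^+ 2 * M ^+ 2 <= g ^+ 2 by rewrite -exprMn ler_sqr ?nnegrE; lra.
  have g3 : (13 / 12) ^+ 3 * M ^+ 3 <= g ^+ 3.
    rewrite -exprMn; apply: lerXn2r; rewrite ?nnegrE; lra.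
  have : (13 / 12) ^+ 3 * M ^+ 3 * (g - r) <= g ^+ 3 * (g - r).
    by rewrite ler_wpM2r// ltW.
  apply: le_trans.
  have : 16 / 9 * M ^+ 2 * s ^+ 2 <= 16 / 9 * M ^+ 2 * (r * (M - r)).
    by rewrite ler_wpM2l// mulr_ge0 ?sqr_ge0//; lra.
  move=> h; apply: (le_trans h); rewrite /g.
  have -> : (13 / 12) ^+ 3 * M ^+ 3 * (4 / 3 * M - r / 4 - r) =
    M ^+ 2 * ((13 / 12) ^+ 3 * M * (4 / 3 * M - r / 4 - r)) by ring.
  have -> : 16 / 9 * M ^+ 2 * (r * (M - r)) = M ^+ 2 * (16 / 9 * (r * (M - r))) by ring.
  rewrite ler_wpM2l ?sqr_ge0//.
  (* The difference of the two sides is a quadratic in [r] with a positive minimum near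
     [r = 0.947 * M]; the square is completed there. *)
  have := sqr_ge0 (r - 947 / 1000 * M); have := sqr_ge0 M.
  by nra.
(* If not, inserting [v < s - g * e] and [x <= e * q] into the lower bound on [v ^+ 2 + x ^+ 2]
   gives [(2 * g - r) * s < g ^+ 2 * e + e * q ^+ 2]. Since [g * e < s] and
   [g * q <= 4 / 3 * M * s], multiplying by [g ^+ 3] contradicts [key]. *)
have bound : s - g * e <= v.
  rewrite leNgt; apply/negP => vs.
  have v2 : v ^+ 2 < (s - g * e) ^+ 2 by rewrite ltr_sqr ?nnegrE//; lra.
  have x2 : x ^+ 2 <= (e * s + r * e ^+ 2 / 4) ^+ 2.
    by rewrite ler_sqr ?nnegrE//; apply: le_trans xs.
  have sp : 0 < s by apply: le_lt_trans gs; rewrite mulr_ge0 ?ltW.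
  set q := s + r * e / 4.
  have q0 : 0 <= q by rewrite /q addr_ge0// divr_ge0// mulr_ge0// ltW.
  have h1 : e * ((2 * g - r) * s) < e * (g ^+ 2 * e + e * q ^+ 2).
    have : (e * s + r * e ^+ 2 / 4) ^+ 2 = e * (e * q ^+ 2) by rewrite /q; ring.
    by lra.
  rewrite ltr_pM2l// in h1.
  have h2 : g ^+ 3 * ((2 * g - r) * s) < g ^+ 3 * (g ^+ 2 * e + e * q ^+ 2).
    by rewrite ltr_pM2l// exprn_gt0.
  have qM : (g * q) ^+ 2 <= (4 / 3 * M * s) ^+ 2.
    rewrite ler_sqr ?nnegrE; [|exact: mulr_ge0 (ltW gp) q0|by rewrite !mulr_ge0//; lra].
    have : r / 4 * (g * e) <= r / 4 * s by rewrite ler_wpM2l ?ltW//; lra.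
    by rewrite /q /g; lra.
  have h3 : g ^+ 3 * (g ^+ 2 * e + e * q ^+ 2) <= s * (g ^+ 4 + (4 / 3 * M * s) ^+ 2).
    have -> : g ^+ 3 * (g ^+ 2 * e + e * q ^+ 2) =
      (g * e) * (g ^+ 4 + (g * q) ^+ 2) by ring.
    apply: ler_pM.
    - exact: mulr_ge0 (ltW gp) (ltW e0).
    - by rewrite addr_ge0 ?sqr_ge0// exprn_ge0// ltW.
    - exact: ltW.
    - by rewrite lerD2l.
  have h4 : s * (g ^+ 3 * (g - r)) < s * (16 / 9 * M ^+ 2 * s ^+ 2).
    have := lt_le_trans h2 h3.
    have -> : g ^+ 3 * ((2 * g - r) * s) = s * (g ^+ 3 * (g - r)) + s * g ^+ 4 by ring.
    have -> : s * (g ^+ 4 + (4 / 3 * M * s) ^+ 2) =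
      s * (16 / 9 * M ^+ 2 * s ^+ 2) + s * g ^+ 4 by field.
    by rewrite ltrD2r.
  by move: h4; rewrite ltr_pM2l// ltNge key.
have : e * (s - g * e) <= e * v by rewrite ler_wpM2l// ltW.
by rewrite /g; lra.
Qed.
End empirical_bernstein_algebra.

(** * Products of functions of independent variables *)

Section independence.
Context {dO dZ : measure_display} {Omega : measurableType dO} {Z : measurableType dZ}.
Context {R : realType} (P : probability Omega R).
Local Open Scope ereal_scope.
Import HBNNSimple.

(** Factorisation passes from indicators to simple functions by linearity, then to nonnegative
    measurable [g] by monotone convergence. *)
Lemma integral_mul_comp_of_indic (nu : probability Z R) (X : Omega -> Z)
    (W : Omega -> R) (c : R) :
  measurable_fun setT X -> measurable_fun setT W -> (forall w, 0 <= W w)%R ->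
  (forall A, measurable A -> \int[P]_w (W w * \1_A (X w))%:E = c%:E * nu A) ->
  forall g : Z -> R, measurable_fun setT g -> (forall z, 0 <= g z)%R ->
  \int[P]_w (W w * g (X w))%:E = c%:E * \int[nu]_z (g z)%:E.
Proof.
move=> mX mW W0 WA g mg g0.
have mg' : measurable_fun [set: Z] (EFin \o g) by apply/measurable_EFinP.
pose h := nnsfun_approx measurableT mg'.
have hcvg z : (h n z)%:E @[n --> \oo] --> (g z)%:E.
  by apply: (@cvg_nnsfun_approx _ _ _ _ measurableT _ mg') => // x _; rewrite lee_fin.
have hnd : forall z, {homo (fun n => h n z) : m n / (m <= n)%N >-> (m <= n)%R}.
  by move=> z m n mn; exact/lefP/nd_nnsfun_approx.
have mhX n : measurable_fun [set: Omega] (fun w => h n (X w)).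
  by apply: measurableT_comp mX.
have simple n : \int[P]_w (W w * h n (X w))%:E = c%:E * \int[nu]_z (h n z)%:E.
  have mI y : measurable_fun [set: Omega] (fun w => (W w * \1_(h n @^-1` [set y]) (X w))%R).
    apply: measurable_funM => //.
    by apply: (measurableT_comp _ mX) => //; exact: measurable_indic.
  transitivity (\int[P]_w \sum_(y \in range (h n))
      (y%:E * (W w * \1_(h n @^-1` [set y]) (X w))%:E)).
    apply: eq_integral => w _.
    rewrite fimfunE EFinM -fsumEFin// ge0_mule_fsumr; last first.
      by move=> y; rewrite EFinM nnfun_muleindic_ge0.
    by apply: eq_fsbigr => y _; rewrite -!EFinM; congr EFin; rewrite mulrCA.
  rewrite ge0_integral_fsum//; last 2 first.
    - by move=> y; apply: measurable_funeM; exact/measurable_EFinP.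
    - move=> y w _; rewrite -EFinM mulrCA EFinM mule_ge0 ?lee_fin//.
      by rewrite -lee_fin EFinM nnfun_muleindic_ge0.
  transitivity (\sum_(y \in range (h n)) c%:E * (y%:E * nu (h n @^-1` [set y]))).
    apply: eq_fsbigr => y; rewrite inE => -[z _ <-].
    rewrite ge0_integralZl//.
    - by rewrite WA// muleCA.
    - exact/measurable_EFinP.
    - by move=> w _; rewrite lee_fin mulr_ge0.
    - by rewrite lee_fin.
  have -> : \int[nu]_z (h n z)%:E =
      \int[nu]_z (\sum_(y \in range (h n)) (y * \1_(h n @^-1` [set y]) z)%:E).
    by apply: eq_integral => z _; rewrite fimfunE -fsumEFin.
  rewrite ge0_integral_fsum//; last 2 first.
    - move=> y; apply/measurable_EFinP; apply: measurable_funM => //.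
    - by move=> y w _; rewrite EFinM nnfun_muleindic_ge0.
  rewrite ge0_mule_fsumr.
    apply: eq_fsbigr => y _.
    by rewrite integralZl_indic_nnsfun// integral_indic// setIT.
  move=> y; apply: integral_ge0 => z _; by rewrite EFinM nnfun_muleindic_ge0.
transitivity (limn (fun n => \int[P]_w (W w * h n (X w))%:E)).
  rewrite -monotone_convergence//=.
  - apply: eq_integral => w _; apply/esym/cvg_lim => //.
    rewrite EFinM; under eq_fun do rewrite EFinM.
    exact: cvgeZl.
  - by move=> n; apply/measurable_EFinP; exact: measurable_funM.
  - by move=> n w _; rewrite lee_fin mulr_ge0.
  - by move=> w _ m n mn; rewrite lee_fin ler_wpM2l// hnd.
under eq_fun do rewrite simple.
rewrite limeMl//.
  congr (_ * _); rewrite -monotone_convergence//=.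
  - by apply: eq_integral => z _; apply/cvg_lim.
  - by move=> n; exact/measurable_EFinP.
  - by move=> n w _; rewrite lee_fin.
  - by move=> w _ m n mn; rewrite lee_fin hnd.
apply/ereal_nondecreasing_is_cvgn => m n mn; apply: ge0_le_integral => //.
- by move=> z _; rewrite lee_fin.
- exact/measurable_EFinP.
- exact/measurable_EFinP.
- by move=> z _; rewrite lee_fin hnd.
Qed.

Context (I : eqType) (X : I -> Omega -> Z) (Q : I -> probability Z R) (s : seq I).
Hypothesis s_uniq : uniq s.
Hypothesis X_measurable : forall p, p \in s -> measurable_fun setT (X p).
Hypothesis X_law : forall p, p \in s -> forall A, measurable A -> P (X p @^-1` A) = Q p A.
Hypothesis X_indep : forall A : I -> set Z, (forall p, p \in s -> measurable (A p)) ->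
  P (\big[setI/setT]_(p <- s) (X p @^-1` A p)) = \prod_(p <- s) P (X p @^-1` A p).

Lemma prod_indic_preimage (A : I -> set Z) (r : seq I) w :
  (\prod_(p <- r) \1_(A p) (X p w) = \1_(\big[setI/setT]_(p <- r) (X p @^-1` A p)) w :> R)%R.
Proof.
elim: r => [|p r IH]; first by rewrite !big_nil indicT.
by rewrite !big_cons indicI/= IH.
Qed.

(** Indicators are replaced by general functions one sample at a time: the prefix [s1] is already
    treated, the suffix [s2] still carries indicators. With [s1] empty this is independence
    itself. *)
Lemma expectation_prod_mixed (g : I -> Z -> R) :
  (forall p, measurable_fun setT (g p)) -> (forall p z, 0 <= g p z)%R ->
  (forall p, \int[Q p]_z (g p z)%:E \is a fin_num) ->
  forall s1 s2, s = s1 ++ s2 -> forall A : I -> set Z, (forall p, measurable (A p)) ->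
  \int[P]_w ((\prod_(p <- s1) g p (X p w)) * (\prod_(p <- s2) \1_(A p) (X p w)))%:E =
  (\prod_(p <- s1) \int[Q p]_z (g p z)%:E) * (\prod_(p <- s2) Q p (A p)).
Proof.
move=> mg g0 gfin; elim/last_ind => [|s1 q IH] s2 es A mA.
  have es2 : s = s2 by [].
  rewrite !big_nil mul1e -es2.
  under eq_integral do rewrite big_nil mul1r prod_indic_preimage.
  rewrite integral_indic// ?setIT.
    apply: (etrans (X_indep A _)) => //; rewrite big_seq [RHS]big_seq; apply: eq_bigr => p ps; exact: X_law.
  rewrite big_seq; apply: bigsetI_measurable => p ps.
  rewrite -[_ @^-1` _]setTI; exact: X_measurable.
have es' : s = s1 ++ q :: s2 by rewrite es cat_rcons.
have qs : q \in s by rewrite es' mem_cat inE eqxx orbT.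
have [qs1 qs2] : q \notin s1 /\ q \notin s2.
  move: s_uniq; rewrite es' cat_uniq cons_uniq /= negb_or.
  by case/and3P => _ /andP[-> _] /andP[-> _].
pose c := fine ((\prod_(p <- s1) \int[Q p]_z (g p z)%:E) * (\prod_(p <- s2) Q p (A p))).
have cE : c%:E = (\prod_(p <- s1) \int[Q p]_z (g p z)%:E) * (\prod_(p <- s2) Q p (A p)).
  rewrite fineK// fin_numM// prode_fin_num// => p _; exact: fin_num_measure.
pose W w := ((\prod_(p <- s1) g p (X p w)) * (\prod_(p <- s2) \1_(A p) (X p w)))%R : R.
transitivity (\int[P]_w (W w * g q (X q w))%:E).
  apply: eq_integral => w _; congr EFin.
  by rewrite /W -cats1 big_cat big_seq1 mulrAC.
rewrite (@integral_mul_comp_of_indic (Q q) (X q) W c) //.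
- by rewrite cE -cats1 big_cat big_seq1 muleAC.
- exact: X_measurable.
- apply: measurable_funM; apply: measurable_prod => p ps.
  + apply: (measurableT_comp (mg p)); apply: X_measurable.
    by rewrite es' mem_cat ps.
  + apply: measurableT_comp; first exact: measurable_indic.
    by apply: X_measurable; rewrite es' mem_cat inE ps !orbT.
- move=> w; apply: mulr_ge0; apply: prodr_ge0 => //.
- move=> B mB.
  (* The indicator case at [q] is the induction hypothesis for the suffix [q :: s2], with [B] placed
     at [q]; as [s] has no repetition, the other factors do not change. *)
  pose A' p := if p == q then B else A p.
  have A's2 p : p \in s2 -> A' p = A p.
    by move=> ps; rewrite /A'; case: eqP => // pq; rewrite -pq ps in qs2.
  have A'q : A' q = B by rewrite /A' eqxx.
  have mA' p : measurable (A' p) by rewrite /A'; case: ifP.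
  have s2A' : \prod_(p <- s2) Q p (A' p) = \prod_(p <- s2) Q p (A p).
    by apply: eq_big_seq => p ps; rewrite A's2.
  have H := IH (q :: s2) es' A' mA'.
  rewrite big_cons A'q s2A' in H.
  rewrite cE -muleA (muleC (\prod_(p <- s2) _)) -H.
  apply: eq_integral => w _; congr EFin.
  rewrite big_cons A'q /W; set a := (\prod_(p <- s1) _)%R; set b := (\1_B _)%R.
  have -> : (\prod_(p <- s2) \1_(A' p) (X p w) = \prod_(p <- s2) \1_(A p) (X p w) :> R)%R.
    by apply: eq_big_seq => p ps; rewrite A's2.
  by rewrite mulrA mulrAC.
Qed.

Lemma expectation_prod (g : I -> Z -> R) :
  (forall p, measurable_fun setT (g p)) -> (forall p z, 0 <= g p z)%R ->
  (forall p, \int[Q p]_z (g p z)%:E \is a fin_num) ->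
  \int[P]_w (\prod_(p <- s) g p (X p w))%:E = \prod_(p <- s) \int[Q p]_z (g p z)%:E.
Proof.
move=> mg g0 gfin.
have := expectation_prod_mixed g mg g0 gfin s [::] (esym (cats0 s)) (fun=> setT)
  (fun=> measurableT).
rewrite big_nil mule1 => <-.
by apply: eq_integral => w _; rewrite big_nil mulr1.
Qed.

End independence.

(** * Concentration in one window *)

Section bounded_integrals.
Context {dZ : measure_display} {Z : measurableType dZ} {R : realType}.
Variables (Q : probability Z R) (f : Z -> R) (w : R).
Hypothesis f_measurable : measurable_fun setT f.
Hypothesis f_bounded : forall z, `|f z| <= w.

Lemma integrable_comp_bounded (h : R -> R) (K : R) :
  measurable_fun setT h -> (forall u, `|u| <= w -> `|h u| <= K) ->
  Q.-integrable setT (EFin \o (h \o f)).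
Proof.
move=> mh hK; apply: measurable_bounded_integrable => //.
- by rewrite ltey_eq fin_num_measure.
- exact: measurableT_comp.
- exists K; split; first exact: num_real.
  by move=> x Kx z _ /=; apply: (le_trans (hK _ (f_bounded z))); exact: ltW.
Qed.

Lemma Rintegral_quad (c al be : R) :
  (\int[Q]_z (1 + al * (f z - c) + be * (f z - c) ^+ 2) =
   1 + al * (Ldist Q f - c) + be * (Vardist Q f + (Ldist Q f - c) ^+ 2))%R.
Proof.
set mu := Ldist Q f.
(* [a] and [k] regroup the integrand as [be * (f - mu) ^+ 2 + a * f + k], whose integral involves
   only the variance and the mean. *)
pose a := al + 2 * be * (mu - c).
pose k := 1 - al * c - 2 * be * (mu - c) * mu + be * (mu - c) ^+ 2.
have if1 : Q.-integrable setT (EFin \o f).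
  by apply: (@integrable_comp_bounded id w) => //; exact: measurable_id.
have if2 : Q.-integrable setT (EFin \o (fun z => (f z - mu) ^+ 2)).
  apply: (@integrable_comp_bounded (fun u => (u - mu) ^+ 2) ((w + `|mu|) ^+ 2)).
    by apply: measurable_funX; apply: measurable_funB.
  move=> u uw; rewrite normrX lerXn2r ?nnegrE ?addr_ge0//.
    exact: le_trans (normr_ge0 u) uw.
  by rewrite (le_trans (ler_normB _ _))// lerD2r.
have ik : Q.-integrable setT (EFin \o (fun=> k)).
  exact: finite_measure_integrable_cst.
have iaf : Q.-integrable setT (EFin \o (fun z => a * f z)).
  apply: (@integrable_comp_bounded (fun u => a * u) (`|a| * w)).
    exact: measurable_funM.
  by move=> u uw; rewrite normrM ler_wpM2l.
have ibf : Q.-integrable setT (EFin \o (fun z => be * (f z - mu) ^+ 2)).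
  exact: (integrableZl measurableT be if2).
have iakf : Q.-integrable setT (EFin \o (fun z => a * f z + k)).
  exact: (integrableD measurableT iaf ik).
have Ik : (\int[Q]_z k)%R = k.
  rewrite Rintegral_cst// -[in RHS](mulr1 k); congr (_ * _).
  exact: (congr1 fine (probability_setT Q)).
transitivity (\int[Q]_z (be * (f z - mu) ^+ 2 + (a * f z + k)))%R.
  by apply: eq_Rintegral => z _; rewrite /a /k; ring.
rewrite RintegralD// RintegralD// RintegralZl// RintegralZl// Ik.
rewrite -/(Vardist Q f) -/(Ldist Q f) -/mu /a /k; ring.
Qed.

Lemma measurable_quad (c al be : R) :
  measurable_fun setT (fun u : R => 1 + al * (u - c) + be * (u - c) ^+ 2).
Proof.
apply: measurable_funD.
  by apply: measurable_funD => //; apply: measurable_funM => //; exact: measurable_funB.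
by apply: measurable_funM => //; apply: measurable_funX; exact: measurable_funB.
Qed.

Lemma integrable_quad (c al be : R) :
  Q.-integrable setT (EFin \o (fun z => 1 + al * (f z - c) + be * (f z - c) ^+ 2)).
Proof.
apply: (@integrable_comp_bounded (fun u => 1 + al * (u - c) + be * (u - c) ^+ 2)
  (1 + `|al| * (w + `|c|) + `|be| * (w + `|c|) ^+ 2)); first exact: measurable_quad.
move=> u uw; have ucw : `|u - c| <= w + `|c|.
  by rewrite (le_trans (ler_normB _ _))// lerD2r.
rewrite (le_trans (ler_normD _ _))// lerD//.
  by rewrite (le_trans (ler_normD _ _))// normr1 lerD2l normrM ler_wpM2l.
rewrite normrM ler_wpM2l// normrX lerXn2r ?nnegrE//.
exact: le_trans ucw.
Qed.

Lemma expectation_quad_le (c al be K : R) :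
  (forall u, `|u| <= w -> al * (u - c) + be * (u - c) ^+ 2 <= K) ->
  al * (Ldist Q f - c) + be * (Vardist Q f + (Ldist Q f - c) ^+ 2) <= K.
Proof.
move=> quadK; rewrite -(lerD2l 1) addrA -Rintegral_quad.
have KE : (\int[Q]_z (1 + K))%R = 1 + K.
  rewrite Rintegral_cst// -[RHS]mulr1; congr (_ * _).
  exact: (congr1 fine (probability_setT Q)).
rewrite -[leRHS]KE; apply: le_Rintegral => //.
- exact: integrable_quad.
- exact: finite_measure_integrable_cst.
- by move=> z _; rewrite -addrA lerD2l quadK.
Qed.

(** Integrate the quadratic majorant, then use [1 + y <= expR y] so that the bounds of different
    samples multiply into one exponential. *)
Lemma expectation_expR_le_quad (phi : R -> R) (c al be : R) :
  measurable_fun setT phi ->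
  (forall u, `|u| <= w -> expR (phi u) <= 1 + al * (u - c) + be * (u - c) ^+ 2) ->
  (\int[Q]_z (expR (phi (f z)))%:E \is a fin_num)%E /\
  fine (\int[Q]_z (expR (phi (f z)))%:E)%E <=
    expR (al * (Ldist Q f - c) + be * (Vardist Q f + (Ldist Q f - c) ^+ 2)).
Proof.
move=> mphi phile.
have iphi : Q.-integrable setT (EFin \o (expR \o phi \o f)).
  apply: (le_integrable measurableT _ _ (integrable_quad c al be)).
    by apply/measurable_EFinP; apply: measurableT_comp => //; exact: measurableT_comp.
  move=> z _ /=; rewrite lee_fin ger0_norm ?expR_ge0//.
  by rewrite (le_trans (phile _ (f_bounded z)))// ler_norm.
split; first exact: (integrable_fin_num measurableT iphi).
apply: le_trans (expR_ge1Dx _).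
rewrite addrA -Rintegral_quad.
by apply: le_Rintegral => //; [exact: integrable_quad|move=> z _; exact: phile].
Qed.

End bounded_integrals.

(** * Chernoff's method with a quadratic majorant *)

Section chernoff.
Context {dO dZ : measure_display} {Omega : measurableType dO} {Z : measurableType dZ}.
Context {R : realType} (P : probability Omega R).
Context (I : eqType) (X : I -> Omega -> Z) (Q : I -> probability Z R) (s : seq I).
Hypothesis s_uniq : uniq s.
Hypothesis X_measurable : forall p, p \in s -> measurable_fun setT (X p).
Hypothesis X_law : forall p, p \in s -> forall A, measurable A -> P (X p @^-1` A) = Q p A.
Hypothesis X_indep : forall A : I -> set Z, (forall p, p \in s -> measurable (A p)) ->
  P (\big[setI/setT]_(p <- s) (X p @^-1` A p)) = (\prod_(p <- s) P (X p @^-1` A p))%E.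
Variables (f : Z -> R) (w c : R).
Hypothesis f_measurable : measurable_fun setT f.
Hypothesis f_bounded : forall z, `|f z| <= w.
Hypothesis c_mean : \sum_(p <- s) (Ldist (Q p) f - c) = 0.

Let m := \sum_(p <- s) (Vardist (Q p) f + (Ldist (Q p) f - c) ^+ 2).

Lemma measurable_sum_comp (phi : R -> R) : measurable_fun setT phi ->
  measurable_fun setT (fun x => \sum_(p <- s) phi (f (X p x))).
Proof.
move=> mphi.
(* [X p] is known to be measurable only for [p] in [s], whereas [measurable_sum] asks for every
   index. *)
rewrite (_ : (fun x => _) =
    fun x => \sum_(p <- s) if p \in s then phi (f (X p x)) else 0); last first.
  by apply/funext => x; apply: eq_big_seq => p ->.
apply: measurable_sum => p; have [ps|_] := boolP (p \in s); last exact: measurable_cst.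
apply: (measurableT_comp mphi); apply: (measurableT_comp f_measurable).
exact: X_measurable.
Qed.

(** The Chernoff parameter is 1, since [phi] absorbs the multiplier. The [al] terms sum to zero by
    [c_mean], so the product of exponential moments is at most [expR (be * m)]. *)
Lemma chernoff_quad (phi : R -> R) (al be L : R) :
  measurable_fun setT phi ->
  (forall u, `|u| <= w -> expR (phi u) <= 1 + al * (u - c) + be * (u - c) ^+ 2) ->
  (P [set x | (be * m + L <= \sum_(p <- s) phi (f (X p x)))%R] <= (expR (- L))%:E)%E.
Proof.
move=> mphi phile.
pose mS := isMeasurableFun.Build _ _ _ _ _ (measurable_sum_comp phi mphi).
pose S : {RV P >-> R} := HB.pack (fun x => \sum_(p <- s) phi (f (X p x))) mS.
have := chernoff S (be * m + L) ltr01.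
move/le_trans; apply.
have -> : ('M_P S 1 = (\prod_(p <- s) fine (\int[Q p]_z (expR (phi (f z)))%:E)%E)%:E)%E.
  rewrite /mmt_gen_fun unlock -prodEFin.
  under [RHS]eq_bigr => p _.
    rewrite fineK; last first.
      by have [] := expectation_expR_le_quad (Q p) f w f_measurable f_bounded
        phi c al be mphi phile.
    over.
  rewrite -(expectation_prod P I X Q s s_uniq X_measurable X_law X_indep
    (fun p z => expR (phi (f z)))).
  - apply: eq_integral => x _ /=; congr EFin.
    by rewrite mulr1 /S /= expR_sum.
  - by move=> p; apply: measurableT_comp => //; apply: measurableT_comp.
  - by move=> p z; exact: expR_ge0.
  - move=> p; by have [] := expectation_expR_le_quad (Q p) f w f_measurable f_bounded
        phi c al be mphi phile.
rewrite -EFinM lee_fin mul1r.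
have -> : - L = be * m + - (be * m + L) by ring.
rewrite expRD ler_wpM2r ?expR_ge0//.
have -> : be * m = \sum_(p <- s) (al * (Ldist (Q p) f - c) +
    be * (Vardist (Q p) f + (Ldist (Q p) f - c) ^+ 2)).
  by rewrite big_split/= -!mulr_sumr c_mean mulr0 add0r.
rewrite expR_sum; apply: ler_prod => p _; apply/andP; split.
  by apply: fine_ge0; apply: integral_ge0 => z _; rewrite lee_fin expR_ge0.
by have [] := expectation_expR_le_quad (Q p) f w f_measurable f_bounded
        phi c al be mphi phile.
Qed.

End chernoff.

(** * Tails of the centred sum and of the sum of squares about [c] *)

Section tails.
Context {dO dZ : measure_display} {Omega : measurableType dO} {Z : measurableType dZ}.
Context {R : realType} (P : probability Omega R).
Context (I : eqType) (X : I -> Omega -> Z) (Q : I -> probability Z R) (s : seq I).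
Hypothesis s_uniq : uniq s.
Hypothesis X_measurable : forall p, p \in s -> measurable_fun setT (X p).
Hypothesis X_law : forall p, p \in s -> forall A, measurable A -> P (X p @^-1` A) = Q p A.
Hypothesis X_indep : forall A : I -> set Z, (forall p, p \in s -> measurable (A p)) ->
  P (\big[setI/setT]_(p <- s) (X p @^-1` A p)) = (\prod_(p <- s) P (X p @^-1` A p))%E.
Variables (f : Z -> R) (w c : R).
Hypothesis w_gt0 : 0 < w.
Hypothesis f_measurable : measurable_fun setT f.
Hypothesis f_bounded : forall z, `|f z| <= w.
Hypothesis c_mean : \sum_(p <- s) (Ldist (Q p) f - c) = 0.

Let m := \sum_(p <- s) (Vardist (Q p) f + (Ldist (Q p) f - c) ^+ 2).
Let r := w + `|c|.
Let chernoff_f := chernoff_quad P I X Q s s_uniq X_measurable X_law X_indep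
  f w c f_measurable f_bounded c_mean.

Let r_gt0 : 0 < r. Proof. by rewrite /r ltr_pwDl. Qed.

Let range_le u : `|u| <= w -> `|u - c| <= r.
Proof. by move=> uw; rewrite (le_trans (ler_normB _ _))// lerD2r. Qed.

Let m_ge0 : 0 <= m.
Proof.
apply: sumr_ge0 => p _; rewrite addr_ge0 ?sqr_ge0//.
by apply: Rintegral_ge0 => z _; exact: sqr_ge0.
Qed.

Let sqr_range_le u : `|u| <= w -> (u - c) ^+ 2 <= r ^+ 2.
Proof.
by move=> /range_le ucr; rewrite -real_normK ?num_real// ler_sqr ?nnegrE// ltW.
Qed.

Lemma measurable_sum_ge (phi : R -> R) (a : R) : measurable_fun setT phi ->
  measurable [set x | a <= \sum_(p <- s) phi (f (X p x))].
Proof.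
move=> mphi; rewrite -[X in measurable X]setTI; apply: measurable_fun_le => //.
exact: (measurable_sum_comp I X s X_measurable f f_measurable).
Qed.

Let measurable_shift : measurable_fun setT (fun u : R => u - c).
Proof. exact: measurable_funB. Qed.

Let measurable_shift_sqr : measurable_fun setT (fun u : R => (u - c) ^+ 2).
Proof. exact: measurable_funX. Qed.

(* [e = 1] and [e = -1] give the two sides.  The positive summand added to [m] keeps the
   exponent [la] finite when [m = 0]. *)
Lemma bernstein_tail (e L : R) : `|e| = 1 -> 0 < L ->
  (P [set x | (Num.sqrt (2 * L) * Num.sqrt (m + r ^+ 2 * L / 72) + r * L / 3
       <= \sum_(p <- s) e * (f (X p x) - c))%R] <= (expR (- L))%:E)%E.
Proof.
move=> e1 L0.
set a := Num.sqrt (2 * L); set V := m + _; set v := Num.sqrt V.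
have a0 : 0 < a by rewrite sqrtr_gt0 mulr_gt0.
have aE : a ^+ 2 = 2 * L by rewrite sqr_sqrtr// mulr_ge0// ltW.
have V0 : 0 < V by rewrite /V ltr_wpDl// divr_gt0// mulr_gt0// exprn_gt0.
have v0 : 0 < v by rewrite sqrtr_gt0.
have vE : v ^+ 2 = V by rewrite sqr_sqrtr// ltW.
have mV : m <= V by rewrite /V lerDl// divr_ge0// mulr_ge0 ?sqr_ge0// ltW.
have d0 : 0 < v + r * a / 3 by rewrite addr_gt0// divr_gt0// mulr_gt0.
(* Bernstein's choice of exponent; with it the final comparison of thresholds, with [V] in place of
   [m], is an equality. *)
pose la := a / (v + r * a / 3).
have la0 : 0 < la by rewrite divr_gt0.
have lar : 1 - la * r / 3 = v / (v + r * a / 3) by rewrite /la; field; rewrite gt_eqF//; lra.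
have be_gt0 : 0 < 1 - la * r / 3 by rewrite lar divr_gt0.
have e2 : e ^+ 2 = 1 by rewrite -real_normK ?num_real// e1 expr1n.
have mphi : measurable_fun setT (fun u : R => la * (e * (u - c))).
  by apply: measurable_funM => //; exact: measurable_funM.
have := chernoff_f (fun u => la * (e * (u - c))) (la * e)
  (la ^+ 2 / (2 * (1 - la * r / 3))) L mphi _.
move=> H; apply: le_trans (H _).
- apply: le_measure; rewrite ?inE.
  + by apply: (measurable_sum_ge (fun u => e * (u - c))); exact: measurable_funM.
  + exact: (measurable_sum_ge (fun u => la * (e * (u - c)))).
  + move=> x /= /(ler_wpM2l (ltW la0)); rewrite mulr_sumr; apply: le_trans.
    rewrite -/m.
    have : la ^+ 2 / (2 * (1 - la * r / 3)) * m <= la ^+ 2 / (2 * (1 - la * r / 3)) * V.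
      by rewrite ler_wpM2l// divr_ge0 ?sqr_ge0// mulr_ge0// ltW.
    rewrite -(lerD2r L) => /le_trans; apply.
    have -> : L = a ^+ 2 / 2 by rewrite aE; field.
    rewrite lar -vE /la le_eqVlt; apply/orP; left; apply/eqP; field.
    by rewrite !gt_eqF//; lra.
- move=> u uw.
  have -> : la ^+ 2 / (2 * (1 - la * r / 3)) * (u - c) ^+ 2 =
      (la * (e * (u - c))) ^+ 2 / (2 * (1 - la * r / 3)).
    by rewrite !exprMn e2 mul1r; ring.
  rewrite -[la * e * _]mulrA; apply: (expR_le_bernstein _ (la * r)).
    rewrite ler_pM2l// (le_trans (ler_norm _))// normrM e1 mul1r; exact: range_le.
  by rewrite mulr_ge0 ?ltW//=; lra.
Qed.

(** With [y = la * (u - c) ^+ 2], the range gives [y ^+ 2 <= la ^+ 2 * r ^+ 2 * (u - c) ^+ 2], so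
    [expRN_le_quad] yields a majorant quadratic in [u - c]. The exponent [la = a / (r * q)] is the
    optimal one. *)
Lemma sum_sqr_lower_tail (L : R) : 0 < L ->
  (P (~` [set x | (m - r * (Num.sqrt (2 * L) * Num.sqrt m)
       <= \sum_(p <- s) (f (X p x) - c) ^+ 2)%R]) <= (expR (- L))%:E)%E.
Proof.
move=> L0.
set a := Num.sqrt (2 * L); set q := Num.sqrt m.
have a0 : 0 < a by rewrite sqrtr_gt0 mulr_gt0.
have aE : a ^+ 2 = 2 * L by rewrite sqr_sqrtr// mulr_ge0// ltW.
have qE : q ^+ 2 = m by rewrite sqr_sqrtr.
(* For [m = 0] the exponent [la] is not meaningful, but the threshold is 0 and squares are
   nonnegative. *)
have [m0|m0] := eqVneq m 0.
  rewrite (_ : [set x | _] = setT) ?setCT ?measure0 ?lee_fin ?expR_ge0//.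
  apply/seteqP; split=> // x _ /=; rewrite /q m0 sqrtr0 !mulr0 subr0.
  by apply: sumr_ge0 => p _; exact: sqr_ge0.
have q0 : 0 < q by rewrite sqrtr_gt0 lt_neqAle eq_sym m0.
pose la := a / (r * q).
have la0 : 0 < la by rewrite divr_gt0// mulr_gt0.
have mphi : measurable_fun setT (fun u : R => - (la * (u - c) ^+ 2)).
  by apply: measurableT_comp => //; exact: measurable_funM.
have := chernoff_f (fun u => - (la * (u - c) ^+ 2)) 0
  (- (la - la ^+ 2 * r ^+ 2 / 2)) L mphi _.
move=> H; apply: le_trans (H _).
- apply: le_measure; rewrite ?inE.
  + by apply: measurableC; exact: (measurable_sum_ge (fun u => (u - c) ^+ 2)).
  + exact: (measurable_sum_ge (fun u => - (la * (u - c) ^+ 2))).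
  + move=> x /= /negP; rewrite -ltNge => /ltW; rewrite sumrN -mulr_sumr => /(ler_wpM2l (ltW la0)).
    rewrite -/m lerNr; move/le_trans; apply.
    have -> : L = a ^+ 2 / 2 by rewrite aE; field.
    rewrite -qE /la le_eqVlt; apply/orP; left; apply/eqP; field.
    by rewrite !gt_eqF.
- move=> u uw.
  have y0 : 0 <= la * (u - c) ^+ 2 by rewrite mulr_ge0 ?sqr_ge0// ltW.
  apply: (le_trans (expRN_le_quad _ y0)).
  have : (la * (u - c) ^+ 2) ^+ 2 <= la ^+ 2 * r ^+ 2 * (u - c) ^+ 2.
    rewrite exprMn -mulrA ler_wpM2l ?sqr_ge0//.
    by rewrite [leLHS]expr2 ler_wpM2r ?sqr_ge0// sqr_range_le.
  by lra.
Qed.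

(** Rescaled by [r ^+ 2], the squares lie in [0,1], where [expR y <= 1 + 2 * y]. The factor 2 is
    harmless: this tail serves only to bound the empirical radius from above. *)
Lemma sum_sqr_upper_tail (L : R) : 0 < L ->
  (P [set x | (2 * m + r ^+ 2 * L <= \sum_(p <- s) (f (X p x) - c) ^+ 2)%R]
     <= (expR (- L))%:E)%E.
Proof.
move=> L0.
have r20 : 0 < r ^+ 2 by rewrite exprn_gt0.
have mphi : measurable_fun setT (fun u : R => (u - c) ^+ 2 / r ^+ 2) by exact: measurable_funM.
have := chernoff_f (fun u => (u - c) ^+ 2 / r ^+ 2) 0 (2 / r ^+ 2) L mphi _.
move=> H; apply: le_trans (H _).
- apply: le_measure; rewrite ?inE.
  + exact: (measurable_sum_ge (fun u => (u - c) ^+ 2)).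
  + exact: (measurable_sum_ge (fun u => (u - c) ^+ 2 / r ^+ 2)).
  + move=> x /=; rewrite -mulr_suml ler_pdivlMr// -/m; apply: le_trans.
    by rewrite mulrDl mulrAC divfK ?gt_eqF// mulrC [L * _]mulrC [m * _]mulrC.
- move=> u uw; rewrite mul0r addr0.
  apply: (le_trans (expR_le_affine _ _)).
    by rewrite divr_ge0 ?sqr_ge0//= ler_pdivrMr// mul1r sqr_range_le.
  by rewrite mulrA mulrAC.
Qed.

End tails.

Lemma sqrtr_subadditive (R : rcfType) (x y : R) : 0 <= x -> 0 <= y ->
  Num.sqrt (x + y) <= Num.sqrt x + Num.sqrt y.
Proof.
move=> x0 y0; rewrite -(@ler_pXn2r _ 2) ?nnegrE ?addr_ge0 ?sqrtr_ge0//.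
rewrite sqrrD !sqr_sqrtr ?addr_ge0// lerD2r lerDl.
by rewrite mulrn_wge0// mulr_ge0 ?sqrtr_ge0.
Qed.

(** * The empirical Bernstein bound for one family of samples *)

Section empirical_bernstein.
Context {dO dZ : measure_display} {Omega : measurableType dO} {Z : measurableType dZ}.
Context {R : realType} (P : probability Omega R).
Context (I : eqType) (X : I -> Omega -> Z) (Q : I -> probability Z R) (s : seq I).
Hypothesis s_uniq : uniq s.
Hypothesis X_measurable : forall p, p \in s -> measurable_fun setT (X p).
Hypothesis X_law : forall p, p \in s -> forall A, measurable A -> P (X p @^-1` A) = Q p A.
Hypothesis X_indep : forall A : I -> set Z, (forall p, p \in s -> measurable (A p)) ->
  P (\big[setI/setT]_(p <- s) (X p @^-1` A p)) = (\prod_(p <- s) P (X p @^-1` A p))%E.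
Variables (f : Z -> R) (w c : R).
Hypothesis w_gt0 : 0 < w.
Hypothesis f_measurable : measurable_fun setT f.
Hypothesis f_bounded : forall z, `|f z| <= w.
Hypothesis s_gt0 : (0 < size s)%N.
Hypothesis c_mean : \sum_(p <- s) (Ldist (Q p) f - c) = 0.

Let m := \sum_(p <- s) (Vardist (Q p) f + (Ldist (Q p) f - c) ^+ 2).
Let r := w + `|c|.
Let N : R := (size s)%:R.
Let N_gt0 : 0 < N. Proof. by rewrite ltr0n. Qed.
Let sum_cst (k : R) : \sum_(p <- s) k = N * k.
Proof. by rewrite big_const_seq count_predT iter_addr_0 mulr_natl. Qed.

Lemma norm_Ldist_le p : `|Ldist (Q p) f| <= w.
Proof.
have H k : (forall u, `|u| <= w -> k * u <= w) -> k * Ldist (Q p) f <= w.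
  move=> Hk; have := expectation_quad_le (Q p) f w f_measurable f_bounded 0 k 0 w _.
  rewrite !subr0 !mul0r !addr0; apply=> u uw.
  by rewrite subr0 mul0r addr0; exact: Hk.
rewrite ler_norml; apply/andP; split.
  rewrite lerNl -mulN1r; apply: H => u uw.
  by rewrite mulN1r (le_trans _ uw)// -normrN ler_norm.
by rewrite -[leLHS]mul1r; apply: H => u uw; rewrite mul1r (le_trans _ uw)// ler_norm.
Qed.

Lemma norm_mean_le : `|c| <= w.
Proof.
have cE : N * c = \sum_(p <- s) Ldist (Q p) f.
  by move: c_mean; rewrite sumrB sum_cst => /eqP; rewrite subr_eq0 => /eqP.
rewrite -(ler_pM2l N_gt0) -{1}(gtr0_norm N_gt0) -normrM cE -sum_cst.
apply: (le_trans (ler_norm_sum _ _ _)).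
by apply: ler_sum => p _; exact: norm_Ldist_le.
Qed.

(* Bhatia-Davis: integrate [(w - u) * (u + w) >= 0]. *)
Lemma sum_variance_le : m <= N * (r * (2 * w - r)).
Proof.
have rE : r * (2 * w - r) = w ^+ 2 - c ^+ 2.
  by rewrite /r -(@real_normK _ c) ?num_real//; ring.
rewrite rE -sum_cst.
(* The added term sums to zero and turns each integrand into [u ^+ 2 - c ^+ 2], which is at most
   [w ^+ 2 - c ^+ 2]. *)
have -> : m = \sum_(p <- s) (2 * c * (Ldist (Q p) f - c) +
    (Vardist (Q p) f + (Ldist (Q p) f - c) ^+ 2)).
  by rewrite big_split/= -mulr_sumr c_mean mulr0 add0r.
apply: ler_sum => p _.
have := expectation_quad_le (Q p) f w f_measurable f_bounded c (2 * c) 1 (w ^+ 2 - c ^+ 2) _.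
rewrite mul1r; apply=> u uw.
have : u ^+ 2 <= w ^+ 2.
  by rewrite -(@real_normK _ u) ?num_real// ler_sqr ?nnegrE// ltW.
by lra.
Qed.

Let m_ge0 : 0 <= m.
Proof.
apply: sumr_ge0 => p _; rewrite addr_ge0 ?sqr_ge0//.
by apply: Rintegral_ge0 => z _; exact: sqr_ge0.
Qed.

Definition sample_mean (x : Omega) : R := N^-1 * \sum_(p <- s) f (X p x).
Definition sample_sum_sqr (x : Omega) : R := \sum_(p <- s) (f (X p x) - sample_mean x) ^+ 2.

Lemma sum_shiftE x : \sum_(p <- s) (f (X p x) - c) = N * (sample_mean x - c).
Proof. by rewrite sumrB sum_cst mulrBr /sample_mean mulrA divff ?mul1r// gt_eqF. Qed.

(** Parallel-axis identity; its last term is the squared deviation that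
    [empirical_bernstein_algebra] absorbs. *)
Lemma sum_shift_sqrE x : \sum_(p <- s) (f (X p x) - c) ^+ 2 =
  sample_sum_sqr x + N * (sample_mean x - c) ^+ 2.
Proof.
set ub := sample_mean x.
have S0 : \sum_(p <- s) (f (X p x) - ub) = 0.
  by rewrite sumrB sum_cst /ub /sample_mean mulrA divff ?mul1r ?subrr// gt_eqF.
transitivity (\sum_(p <- s) (2 * (ub - c) * (f (X p x) - ub) +
    ((f (X p x) - ub) ^+ 2 + (ub - c) ^+ 2))).
  by apply: eq_bigr => p _; ring.
by rewrite !big_split/= -mulr_sumr S0 mulr0 add0r sum_cst.
Qed.

(** Divided by [N], the two tail bounds become the hypotheses of [empirical_bernstein_algebra] with
    [M = 2 * w], [s ^+ 2 = m / N], [v ^+ 2 = sample_sum_sqr x / N] and [e ^+ 2 = 2 * L / N]. *)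
Lemma deviation_le_of_tails (L : R) (x : Omega) : 0 < L ->
  `|\sum_(p <- s) (f (X p x) - c)| <=
    Num.sqrt (2 * L) * Num.sqrt (m + r ^+ 2 * L / 72) + r * L / 3 ->
  m - r * (Num.sqrt (2 * L) * Num.sqrt m) <= \sum_(p <- s) (f (X p x) - c) ^+ 2 ->
  `|sample_mean x - c| <= Num.sqrt (sample_sum_sqr x / N) * Num.sqrt (2 * L / N)
    + 16 * w * L / (3 * N).
Proof.
move=> L0; rewrite sum_shiftE sum_shift_sqrE normrM (gtr0_norm N_gt0) => H1 H2.
have r0 : 0 < r by rewrite /r ltr_pwDl.
set e := Num.sqrt (2 * L / N).
have eE : e ^+ 2 = 2 * L / N by rewrite sqr_sqrtr// divr_ge0// ltW// mulr_gt0.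
have SS0 : 0 <= sample_sum_sqr x by apply: sumr_ge0 => p _; exact: sqr_ge0.
have sNe : Num.sqrt (2 * L) = Num.sqrt N * e.
  by rewrite -sqrtrM ?(ltW N_gt0)//; congr Num.sqrt; field; rewrite gt_eqF.
have smN : Num.sqrt m = Num.sqrt N * Num.sqrt (m / N).
  by rewrite -sqrtrM ?(ltW N_gt0)//; congr Num.sqrt; field; rewrite gt_eqF.
have sN2 : Num.sqrt N ^+ 2 = N by rewrite sqr_sqrtr// ltW.
have smE : Num.sqrt (2 * L) * Num.sqrt m = N * (e * Num.sqrt (m / N)).
  by rewrite smN sNe mulrACA -expr2 sN2.
have k0 : 0 <= r ^+ 2 * L / 72 by rewrite divr_ge0// mulr_ge0 ?sqr_ge0// ltW.
(* The 72 is chosen for this: [r * L / 6 + r * L / 3 = r * L / 2], which is [N] times the term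
   [r * e ^+ 2 / 4]. *)
have sk : Num.sqrt (2 * L) * Num.sqrt (r ^+ 2 * L / 72) = r * L / 6.
  rewrite -sqrtrM; last by rewrite mulr_ge0// ltW.
  have -> : 2 * L * (r ^+ 2 * L / 72) = (r * L / 6) ^+ 2 by field.
  by rewrite sqrtr_sqr gtr0_norm// divr_gt0// mulr_gt0.
have -> : 16 * w * L / (3 * N) = 4 / 3 * (2 * w) * e ^+ 2.
  by rewrite eE; field; rewrite gt_eqF.
rewrite [_ * e]mulrC.
have rw := norm_mean_le.
apply: (empirical_bernstein_algebra (2 * w) r e `|sample_mean x - c| (Num.sqrt (m / N))) => //.
- by rewrite /r; lra.
- by rewrite sqrtr_gt0 divr_gt0// mulr_gt0.
- rewrite sqr_sqrtr ?divr_ge0 ?(ltW N_gt0)// ler_pdivrMr// [leRHS]mulrC.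
  exact: sum_variance_le.
- rewrite -(ler_pM2l N_gt0); apply: (le_trans H1).
  have := sqrtr_subadditive _ _ _ m_ge0 k0.
  have a0 : 0 <= Num.sqrt (2 * L) by exact: sqrtr_ge0.
  move=> /(ler_wpM2l a0); rewrite mulrDr sk -(lerD2r (r * L / 3)) => /le_trans; apply.
  rewrite smE.
  rewrite eE le_eqVlt; apply/orP; left; apply/eqP; field; by rewrite gt_eqF.
- rewrite sqr_sqrtr ?divr_ge0 ?(ltW N_gt0)// sqr_sqrtr ?divr_ge0 ?(ltW N_gt0)//.
  rewrite -(ler_pM2l N_gt0) real_normK ?num_real//.
  have -> : N * (sample_sum_sqr x / N + (sample_mean x - c) ^+ 2) =
    sample_sum_sqr x + N * (sample_mean x - c) ^+ 2 by field; rewrite gt_eqF.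
  apply: le_trans H2.
  rewrite smE.
  rewrite le_eqVlt; apply/orP; left; apply/eqP; field; by rewrite gt_eqF.
Qed.

Lemma deviation_le_range x : `|sample_mean x - c| <= 2 * w.
Proof.
have mw : `|sample_mean x| <= w.
  rewrite -(ler_pM2l N_gt0) -{1}(gtr0_norm N_gt0) -normrM /sample_mean mulrA divff ?gt_eqF//.
  rewrite mul1r -sum_cst (le_trans (ler_norm_sum _ _ _))//.
  by apply: ler_sum => p _; exact: f_bounded.
by rewrite (le_trans (ler_normB _ _))// mulr_natl mulr2n lerD// norm_mean_le.
Qed.

(** A union bound over four events: the two sides of Bernstein and the two tails of the sum of
    squares, each of probability at most [expR (- L)]. *)
Lemma empirical_bernstein (L : R) : 0 < L -> exists G : set Omega,
  [/\ measurable G, (P (~` G) <= (4 * expR (- L))%:E)%E &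
  forall x, G x ->
    `|sample_mean x - c| <= Num.sqrt (sample_sum_sqr x / N) * Num.sqrt (2 * L / N)
      + 16 * w * L / (3 * N) /\
    sample_sum_sqr x <= 2 * m + (2 * w) ^+ 2 * L].
Proof.
move=> L0.
pose dev := Num.sqrt (2 * L) * Num.sqrt (m + r ^+ 2 * L / 72) + r * L / 3.
pose B e := [set x | dev <= \sum_(p <- s) e * (f (X p x) - c)].
pose G3 := [set x | m - r * (Num.sqrt (2 * L) * Num.sqrt m)
  <= \sum_(p <- s) (f (X p x) - c) ^+ 2].
pose B4 := [set x | 2 * m + r ^+ 2 * L <= \sum_(p <- s) (f (X p x) - c) ^+ 2].
have ms : measurable_fun setT (fun u : R => u - c) by exact: measurable_funB.
have mB e : measurable (B e).
  apply: (measurable_sum_ge I X s X_measurable f f_measurable (fun u => e * (u - c))).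
  exact: measurable_funM.
have mG3 : measurable G3.
  apply: (measurable_sum_ge I X s X_measurable f f_measurable (fun u => (u - c) ^+ 2)).
  exact: measurable_funX.
have mB4 : measurable B4.
  apply: (measurable_sum_ge I X s X_measurable f f_measurable (fun u => (u - c) ^+ 2)).
  exact: measurable_funX.
have PB e : `|e| = 1 -> (P (B e) <= (expR (- L))%:E)%E.
  by move=> e1; apply: (bernstein_tail P I X Q s).
have PG3 : (P (~` G3) <= (expR (- L))%:E)%E by apply: (sum_sqr_lower_tail P I X Q s).
have PB4 : (P B4 <= (expR (- L))%:E)%E by apply: (sum_sqr_upper_tail P I X Q s).
exists (~` ((B 1 `|` B (-1)) `|` (~` G3 `|` B4))); split.
- by apply: measurableC; apply: measurableU; apply: measurableU => //; exact: measurableC.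
- rewrite setCK.
  have -> : 4 * expR (- L) = (expR (- L) + expR (- L)) + (expR (- L) + expR (- L)) by ring.
  rewrite !EFinD.
  apply: le_trans (measureU2 _ _ _) _.
  + exact: measurableU.
  + by apply: measurableU => //; exact: measurableC.
  + apply: leeD.
      apply: le_trans (measureU2 _ _ _) _ => //; apply: leeD; apply: PB.
        exact: normr1.
      by rewrite normrN normr1.
    by apply: le_trans (measureU2 _ _ _) _ => //; [exact: measurableC|exact: leeD].
- move=> x /= nb.
  have nB1 : ~ B 1 x by move=> b; apply: nb; left; left.
  have nB2 : ~ B (-1) x by move=> b; apply: nb; left; right.
  have g3 : G3 x by apply: contrapT => b; apply: nb; right; left.
  have nB4 : ~ B4 x by move=> b; apply: nb; right; right.
  have rw : r <= 2 * w by have := norm_mean_le; rewrite /r; lra.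
  have r0 : 0 < r by rewrite /r ltr_pwDl.
  split.
    apply: deviation_le_of_tails => //.
    move/negP: nB1; rewrite -ltNge -mulr_sumr mul1r => h1.
    move/negP: nB2; rewrite -ltNge -mulr_sumr mulN1r => h2.
    by rewrite ler_norml lerNl -/dev !ltW.
  move/negP: nB4; rewrite -ltNge sum_shift_sqrE => h4.
  have : r ^+ 2 * L <= (2 * w) ^+ 2 * L.
    by rewrite ler_wpM2r ?(ltW L0)// ler_sqr ?nnegrE ?(ltW r0)//; lra.
  have : 0 <= N * (sample_mean x - c) ^+ 2 by rewrite mulr_ge0 ?sqr_ge0// ltW.
  by lra.
Qed.

End empirical_bernstein.

(** Replacing [n] by [n - 1] only enlarges the radius, so it still dominates [dev]; since
    [(n - 1)^-1 <= 2 / n] for [n >= 2], the enlargement costs only constants. For [n = 1] the range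
    bound takes over. *)
Lemma empirical_bernstein_radius_bounds (R : realType) (n : nat) (SS sig2 A w L dev : R) :
  (0 < n)%N -> 1 <= L -> 0 < w -> 0 <= A -> 0 <= sig2 -> 0 <= SS ->
  dev <= 2 * w ->
  dev <= Num.sqrt (SS / n%:R) * Num.sqrt (2 * L / n%:R) + 16 * w * L / (3 * n%:R) ->
  SS <= 2 * (n%:R * (sig2 + 4 * A ^+ 2)) + (2 * w) ^+ 2 * L ->
  let psi := if n == 1%N then 2 * w
    else Num.sqrt ((n - 1)%:R^-1 * SS) * Num.sqrt (2 * L / n%:R)
         + 8 * (2 * w) * L / (3 * (n - 1)%:R) in
  dev <= psi /\
  psi <= L * (3 * (Num.sqrt sig2 / Num.sqrt n%:R) + 4 * A + 15 * (w / n%:R)).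
Proof.
move=> n0 L1 w0 A0 sig0 SS0 devw devb SSb psi.
have L0 : 0 < L by exact: lt_le_trans L1.
rewrite /psi; have [n1|n1] := eqVneq n 1%N.
  split=> //; rewrite n1 sqrtr1 !divr1.
  have : 0 <= L * (3 * Num.sqrt sig2 + 4 * A).
    by rewrite mulr_ge0 ?(ltW L0)// addr_ge0 ?mulr_ge0 ?sqrtr_ge0.
  have : w <= L * w by rewrite ler_peMl// ltW.
  by lra.
have n2 : (1 < n)%N by rewrite ltn_neqAle eq_sym n1.
have nE : (n - 1)%:R = n%:R - 1 :> R by rewrite natrB.
rewrite nE; move: devb SSb; set N : R := n%:R => devb SSb.
have N2 : 2 <= N by rewrite /N ler_nat.
have N0 : 0 < N by lra.
have N1 : 0 < N - 1 by lra.
have iN : (N - 1)^-1 <= 2 / N by rewrite ler_pdivlMr// mulrC ler_pdivrMr//; lra.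
have iN' : N^-1 <= (N - 1)^-1 by rewrite lef_pV2 ?posrE//; lra.
set e := Num.sqrt (2 * L / N).
have e0 : 0 <= e by exact: sqrtr_ge0.
have eE : e ^+ 2 = 2 * L / N by rewrite sqr_sqrtr// divr_ge0 ?(ltW N0)// mulr_ge0// ltW.
have V0 : 0 <= (N - 1)^-1 * SS by rewrite mulr_ge0// invr_ge0 ltW.
split.
  apply: (le_trans devb); apply: lerD.
    by rewrite ler_wpM2r// ler_wsqrtr// mulrC ler_wpM2r.
  have -> : 16 * w * L / (3 * N) = 16 / 3 * w * L * N^-1 by field; rewrite gt_eqF.
  have -> : 8 * (2 * w) * L / (3 * (N - 1)) = 16 / 3 * w * L * (N - 1)^-1.
    by field; rewrite gt_eqF.
  by rewrite ler_wpM2l// !mulr_ge0// ltW.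
(* The bound on [SS] times [2 / N] is [4 * sig2 + 16 * A ^+ 2 + 4 * w ^+ 2 * e ^+ 2], the sum of the
   squares of the three terms on the right. *)
have sqV : Num.sqrt ((N - 1)^-1 * SS) <= 2 * Num.sqrt sig2 + 4 * A + 2 * w * e.
  have q0 : 0 <= Num.sqrt sig2 by exact: sqrtr_ge0.
  have we0 : 0 <= w * e by rewrite mulr_ge0// ltW.
  rewrite -(@ler_pXn2r _ 2) ?nnegrE ?sqrtr_ge0//; last by lra.
  rewrite sqr_sqrtr//.
  apply: (@le_trans _ _ (4 * sig2 + 16 * A ^+ 2 + 4 * w ^+ 2 * e ^+ 2)).
    have : (N - 1)^-1 * SS <= 2 / N * SS by rewrite ler_wpM2r.
    move/le_trans; apply.
    have h : 0 <= 2 / N by rewrite divr_ge0// ltW.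
    apply: (le_trans (ler_wpM2l h SSb)); rewrite eE le_eqVlt; apply/orP; left; apply/eqP.
    by field; rewrite gt_eqF.
  have sE : sig2 = Num.sqrt sig2 ^+ 2 by rewrite sqr_sqrtr.
  rewrite {1}sE.
  have := mulr_ge0 q0 A0; have := mulr_ge0 q0 we0; have := mulr_ge0 A0 we0.
  by nra.
(* Here and in [eN], [1 <= L] lets [L ^+ 2] dominate [L]: the squared claims reduce to
   [2 * L <= L ^+ 2 * N] and [8 * L <= 9 * L ^+ 2]. *)
have eL : e <= L.
  rewrite -(@ler_pXn2r _ 2) ?nnegrE ?(ltW L0)// eE ler_pdivrMr//.
  have : L * 1 <= L * L by rewrite ler_pM2l.
  have : L ^+ 2 * 2 <= L ^+ 2 * N by rewrite ler_wpM2l// sqr_ge0.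
  by lra.
have eN : 2 * e <= 3 * L / Num.sqrt N.
  rewrite ler_pdivlMr ?sqrtr_gt0// -(@ler_pXn2r _ 2) ?nnegrE//; last 2 first.
  - by rewrite !mulr_ge0// sqrtr_ge0.
  - by rewrite mulr_ge0// ltW.
  rewrite !exprMn eE sqr_sqrtr ?(ltW N0)//.
  have -> : 2 ^+ 2 * (2 * L / N) * N = 8 * L by field; rewrite gt_eqF.
  have : L * 1 <= L * L by rewrite ler_pM2l.
  by lra.
have q0 : 0 <= Num.sqrt sig2 by exact: sqrtr_ge0.
have t1 : Num.sqrt ((N - 1)^-1 * SS) * e <=
    3 * L / Num.sqrt N * Num.sqrt sig2 + 4 * A * L + 4 * w * L / N.
  apply: (le_trans (ler_wpM2r e0 sqV)).
  have h1 := ler_wpM2r q0 eN.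
  have h2 := ler_wpM2l A0 eL.
  have -> : 4 * w * L / N = 2 * w * e ^+ 2 by rewrite eE; field; rewrite gt_eqF.
  by lra.
have t2 : 8 * (2 * w) * L / (3 * (N - 1)) <= 32 / 3 * (L * (w / N)).
  have -> : 8 * (2 * w) * L / (3 * (N - 1)) = 16 / 3 * w * L * (N - 1)^-1.
    by field; rewrite gt_eqF.
  have -> : 32 / 3 * (L * (w / N)) = 16 / 3 * w * L * (2 / N) by field; rewrite gt_eqF.
  by rewrite ler_wpM2l// !mulr_ge0// ltW.
(* The range terms of [t1] and [t2] have coefficients 4 and 32/3, together below 15. *)
have t3 : 0 <= L * (w / N) by rewrite mulr_ge0 ?divr_ge0 ?ltW.
have e1 : 3 * L / Num.sqrt N * Num.sqrt sig2 = 3 * (L * (Num.sqrt sig2 / Num.sqrt N)) by ring.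
have e2 : 4 * w * L / N = 4 * (L * (w / N)) by ring.
have -> : L * (3 * (Num.sqrt sig2 / Num.sqrt N) + 4 * A + 15 * (w / N)) =
  3 * (L * (Num.sqrt sig2 / Num.sqrt N)) + 4 * (A * L) + 15 * (L * (w / N)) by ring.
rewrite e1 e2 in t1; lra.
Qed.

(** * Lepski's argument and the rolling window *)

Section lepski.
Context {R : realType}.
Variables (B : nat -> nat) (u : nat -> nat -> R) (M delta' : R) (t : nat).
Variables (c A : nat -> R) (D : R).
Hypothesis mu_psi : forall k, (1 <= k <= t)%N ->
  `|mu_hat B u t k - c k| <= psi_hat B u M delta' t k.
Hypothesis c_bias : forall k, (1 <= k <= t)%N -> `|c k - D| <= A k.
Hypothesis A_mono : forall i k, (1 <= i)%N -> (i <= k)%N -> (k <= t)%N -> A i <= A k.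

(** Two window estimates differ by at most their radii plus their biases; [phi_hat] subtracts the
    radii, and by monotonicity both biases are at most [A k]. *)
Lemma phi_hat_le_bias k : (1 <= k <= t)%N -> phi_hat B u M delta' t k <= 2 * A k.
Proof.
move=> hk; case/andP: (hk) => k1 kt.
have A0 : 0 <= A k := le_trans (normr_ge0 _) (c_bias k hk).
rewrite /phi_hat big_seq_cond; apply: (big_ind (fun x => x <= 2 * A k)).
- by rewrite mulr_ge0.
- by move=> x y xA yA; rewrite ge_max xA.
move=> i; rewrite mem_index_iota ltnS andbT => /andP[i1 ik].
have it : (1 <= i <= t)%N by rewrite i1 (leq_trans ik).
rewrite ge_max mulr_ge0// andbT.
have := c_bias i it; have := c_bias k hk.
have := mu_psi i it; have := mu_psi k hk.
have := A_mono i k i1 ik kt.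
rewrite !ler_norml => h /andP[? ?] /andP[? ?] /andP[? ?] /andP[? ?].
suff : `|mu_hat B u t k - mu_hat B u t i| <= 2 * A k + (psi_hat B u M delta' t k + psi_hat B u M delta' t i) by lra.
by rewrite ler_norml; apply/andP; split; lra.
Qed.

Lemma le_phi_hat i k : (1 <= i)%N -> (i <= k)%N ->
  `|mu_hat B u t k - mu_hat B u t i| <=
    phi_hat B u M delta' t k + (psi_hat B u M delta' t k + psi_hat B u M delta' t i).
Proof.
move=> i1 ik; rewrite -lerBlDr; apply: (@le_trans _ _ (Num.max
  (`|mu_hat B u t k - mu_hat B u t i| -
    (psi_hat B u M delta' t k + psi_hat B u M delta' t i)) 0)).
  by rewrite le_max lexx.
rewrite /phi_hat; apply: (le_bigmax_seq _ i) => //.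
by rewrite mem_index_iota i1 ltnS.
Qed.

Lemma is_khat_error_le khat k : is_khat B u M delta' t khat -> (1 <= k <= t)%N ->
  `|mu_hat B u t khat - D| <= 3 * (A k + psi_hat B u M delta' t k).
Proof.
move=> [hk hmin] kt.
have psi0 i : (1 <= i <= t)%N -> 0 <= psi_hat B u M delta' t i.
  by move=> it; exact: le_trans (normr_ge0 _) (mu_psi i it).
have phi0 i : 0 <= phi_hat B u M delta' t i.
  rewrite /phi_hat; apply: (big_ind (fun x => 0 <= x)) => //; first by move=> x y x0 _; rewrite le_max x0.
  by move=> j _; rewrite le_max lexx orbT.
have opt := hmin k kt; have phik := phi_hat_le_bias k kt.
have := psi0 k kt; have := psi0 khat hk; have := phi0 khat; move=> p1 p2 p3.
(* A shorter window has bias at most [A k], and minimality bounds its radius by [2 * A k] plus the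
   radius of [k]. A longer one is compared with window [k] inside [phi_hat], and minimality bounds
   that comparison. *)
have [hkk|kkh] := leqP khat k.
  have := A_mono khat k _ hkk _; case/andP: (hk) => h1 _; case/andP: (kt) => _ k2.
  move=> /(_ h1 k2) hA.
  have := mu_psi khat hk; have := c_bias khat hk.
  rewrite !ler_norml => /andP[? ?] /andP[? ?]; apply/andP; split; lra.
have k1 : (1 <= k)%N by case/andP: kt.
have := le_phi_hat k khat k1 (ltnW kkh).
have := mu_psi k kt; have := c_bias k kt.
rewrite !ler_norml => /andP[? ?] /andP[? ?] /andP[? ?]; apply/andP; split; lra.
Qed.

End lepski.

Lemma le_mul_min_range (R : realType) (X : nat -> R) (t : nat) (y C : R) : (1 <= t)%N ->
  (forall k, (1 <= k <= t)%N -> y <= C * X k) -> y <= C * min_range X t.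
Proof.
move=> t1 H; rewrite /min_range big_seq_cond.
apply: (big_ind (fun x => y <= C * x)).
(* The default value [X 1] of the minimum is itself a candidate, because [1 <= t]. *)
- by apply: H; rewrite t1.
- by move=> x1 x2 h1 h2; rewrite minEle; case: ifP.
- by move=> k; rewrite andbT mem_index_iota ltnS => /H.
Qed.

(** * The samples of a window as a flat list, and their independence *)

Definition window_index (B : nat -> nat) (t k : nat) : seq (nat * nat) :=
  [seq (j, i) | j <- index_iota (t - k + 1) t.+1, i <- iota 0 (B j)].

Section window_index.
Variables (B : nat -> nat) (t : nat).

Lemma sum_window_index (V : nmodType) (k : nat) (F : nat * nat -> V) :
  \sum_(p <- window_index B t k) F p =
  \sum_(t - k + 1 <= j < t.+1) \sum_(i < B j) F (j, nat_of_ord i).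
Proof.
rewrite big_allpairs_dep; apply: eq_bigr => j _.
by rewrite -(big_mkord xpredT (fun i => F (j, i))) /index_iota subn0.
Qed.

Lemma size_window_index k : size (window_index B t k) = Bsum B t k.
Proof.
rewrite size_allpairs_dep sumnE big_map.
by apply: eq_bigr => j _; rewrite size_iota.
Qed.

Lemma mem_window_index k p : (1 <= k <= t)%N -> p \in window_index B t k ->
  [/\ (1 <= p.1 <= t)%N, (t - k + 1 <= p.1 < t.+1)%N & (p.2 < B p.1)%N].
Proof.
move=> kt /allpairsPdep [j [i [+ + ->]]] /=.
rewrite mem_index_iota mem_iota /= add0n => /andP[j1 j2] ->.
by rewrite j1 j2 (leq_trans _ j1) ?addn1.
Qed.

Lemma uniq_sample_index : uniq (sample_index B t).
Proof.
apply: allpairs_uniq_dep; first exact: iota_uniq.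
  by move=> j _; exact: iota_uniq.
by move=> [j i] [j' i'] _ _ /= [-> ->].
Qed.

(** Both lists run through the periods in increasing order, so the last [k] periods form a suffix;
    this is how a window inherits independence. *)
Lemma sample_index_split k : (1 <= k <= t)%N -> exists s0,
  sample_index B t = s0 ++ window_index B t k.
Proof.
move=> /andP[k1 kt].
exists [seq (j, i) | j <- iota 1 (t - k), i <- iota 0 (B j)].
rewrite /window_index -allpairs_cat /index_iota; congr allpairs_dep.
have -> : (t.+1 - (t - k + 1) = k)%N by rewrite addn1 subSS subKn.
by rewrite addnC -iotaD subnK.
Qed.

End window_index.

(** Impose the trivial event [setT] on the prefix. Uniqueness keeps prefix indices out of [s1], so
    the extended family [A'] is consistent. *)
Lemma mutually_independent_suffix {dO dZ} {Omega : measurableType dO}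
    {Z : measurableType dZ} {R : realType} (P : probability Omega R)
    (z : nat -> nat -> Omega -> Z) (s0 s1 : seq (nat * nat)) :
  uniq (s0 ++ s1) -> mutually_independent P z (s0 ++ s1) -> mutually_independent P z s1.
Proof.
rewrite cat_uniq => /and3P[_ /hasPn s01 _] ind A mA.
pose A' j i := if (j, i) \in s1 then A j i else setT.
have A'1 p : p \in s1 -> A' p.1 p.2 = A p.1 p.2 by case: p => j i ps; rewrite /A' ps.
have A'0 p : p \in s0 -> A' p.1 p.2 = setT.
  case: p => j i ps; rewrite /A'; case: ifPn => // ps1.
  by have := s01 _ ps1; rewrite /= ps.
have := ind A' _; rewrite !big_cat/=.
rewrite (eq_big_seq (fun=> setT) (r := s0)); last by move=> p /A'0 ->; rewrite preimage_setT.
rewrite big1_eq setTI.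
rewrite (eq_big_seq (fun p => z p.1 p.2 @^-1` A p.1 p.2) (r := s1)); last first.
  by move=> p /A'1 ->.
move=> ->; last first.
  move=> p _; rewrite /A'; case: ifPn => // ps.
  by apply: mA; case: p ps.
rewrite (eq_big_seq (fun=> 1%E) (r := s0)); last first.
  by move=> p /A'0 ->; rewrite preimage_setT probability_setT.
rewrite big1_eq mul1e.
by apply: eq_big_seq => p /A'1 ->.
Qed.

(** * Good events for all windows of the procedure *)

Section rolling_window.
Context {dO dZ : measure_display} {Omega : measurableType dO} {Z : measurableType dZ}.
Context {R : realType} (P : probability Omega R) (Pj : nat -> probability Z R).
Variables (B : nat -> nat) (z : nat -> nat -> Omega -> Z) (t : nat).
Variables (f : Z -> R) (w : R).
Hypothesis B_gt0 : forall j, (1 <= B j)%N.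
Hypothesis z_measurable : forall j i, (1 <= j <= t)%N -> (i < B j)%N ->
  measurable_fun setT (z j i).
Hypothesis z_law : forall j i, (1 <= j <= t)%N -> (i < B j)%N ->
  forall A, measurable A -> P (z j i @^-1` A) = Pj j A.
Hypothesis z_indep : mutually_independent P z (sample_index B t).
Hypothesis w_gt0 : 0 < w.
Hypothesis f_measurable : measurable_fun setT f.
Hypothesis f_bounded : forall y, `|f y| <= w.

Let Delta j := Ldist (Pj j) f.
Let bias k := max_window (fun j => `|Delta j - Delta t|) t k.
Let sigma2 k := (Bsum B t k)%:R^-1 *
  \sum_(t - k + 1 <= j < t.+1) (B j)%:R * Vardist (Pj j) f.
(** Each period counts once per sample, so this is the expectation of [mu_hat] and the centring
    constant of the concentration bounds. *)
Let window_mean k :=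
  (Bsum B t k)%:R^-1 * \sum_(p <- window_index B t k) Delta p.1.

Lemma Bsum_gt0 k : (1 <= k <= t)%N -> (0 < Bsum B t k)%N.
Proof.
move=> /andP[k1 kt]; rewrite /Bsum big_nat_recr/=; last first.
  by rewrite addn1 ltn_subrL k1 (leq_trans k1).
by rewrite addn_gt0 B_gt0 orbT.
Qed.

Let N k : R := (Bsum B t k)%:R.
Let N_gt0 k : (1 <= k <= t)%N -> 0 < N k.
Proof. by move=> kt; rewrite ltr0n Bsum_gt0. Qed.

Lemma sum_window_cst k (x : R) : \sum_(p <- window_index B t k) x = N k * x.
Proof. by rewrite big_const_seq count_predT iter_addr_0 size_window_index mulr_natl. Qed.

Lemma window_mean_centered k : (1 <= k <= t)%N ->
  \sum_(p <- window_index B t k) (Delta p.1 - window_mean k) = 0.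
Proof.
move=> kt; rewrite sumrB sum_window_cst /window_mean mulrA divff ?mul1r ?subrr//.
by rewrite gt_eqF// N_gt0.
Qed.

Lemma bias_ge0 k : 0 <= bias k.
Proof.
rewrite /bias /max_window; apply: (big_ind (fun x => 0 <= x)) => //.
by move=> x y x0 _; rewrite le_max x0.
Qed.

Lemma le_bias k j : (t - k + 1 <= j < t.+1)%N -> `|Delta j - Delta t| <= bias k.
Proof.
move=> jk; rewrite /bias /max_window.
apply: (le_bigmax_seq _ j predT (fun j => `|Delta j - Delta t|)) => //.
by rewrite mem_index_iota.
Qed.

Lemma bias_mono i k : (i <= k)%N -> bias i <= bias k.
Proof.
move=> ik; rewrite {1}/bias /max_window big_seq_cond.
apply: (big_ind (fun x => x <= bias k)).
- exact: bias_ge0.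
- by move=> x y xb yb; rewrite ge_max xb.
move=> j; rewrite mem_index_iota andbT => /andP[j1 j2].
apply: le_bias; rewrite j2 andbT (leq_trans _ j1)// leq_add2r.
exact: leq_sub2l.
Qed.

Lemma window_mean_bias k : (1 <= k <= t)%N -> `|window_mean k - Delta t| <= bias k.
Proof.
move=> kt; rewrite -(ler_pM2l (N_gt0 k kt)) -{1}(gtr0_norm (N_gt0 k kt)) -normrM.
have -> : N k * (window_mean k - Delta t) =
    \sum_(p <- window_index B t k) (Delta p.1 - Delta t).
  rewrite sumrB sum_window_cst mulrBr /window_mean mulrA divff ?mul1r//.
  by rewrite gt_eqF// N_gt0.
rewrite -sum_window_cst (le_trans (ler_norm_sum _ _ _))//.
rewrite big_seq [leRHS]big_seq; apply: ler_sum => p ps.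
by apply: le_bias; have [] := mem_window_index _ _ _ _ kt ps.
Qed.

Lemma sigma2E k : (1 <= k <= t)%N ->
  N k * sigma2 k = \sum_(p <- window_index B t k) Vardist (Pj p.1) f.
Proof.
move=> kt; rewrite /sigma2 mulrA divff ?mul1r ?gt_eqF ?N_gt0// sum_window_index.
by apply: eq_bigr => j _; rewrite /= sumr_const card_ord mulr_natl.
Qed.

Lemma sigma2_ge0 k : 0 <= sigma2 k.
Proof.
rewrite mulr_ge0 ?invr_ge0//; apply: sumr_ge0 => j _; rewrite mulr_ge0//.
by apply: Rintegral_ge0 => y _; exact: sqr_ge0.
Qed.

(** The mean of each period and the window mean both lie within [bias k] of [Delta t], hence within
    [2 * bias k] of each other. *)
Lemma second_moment_le k : (1 <= k <= t)%N ->
  \sum_(p <- window_index B t k) (Vardist (Pj p.1) f + (Delta p.1 - window_mean k) ^+ 2) <=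
  N k * (sigma2 k + 4 * bias k ^+ 2).
Proof.
move=> kt; rewrite big_split/= mulrDr sigma2E// lerD2l -sum_window_cst.
rewrite big_seq [leRHS]big_seq; apply: ler_sum => p ps.
have -> : 4 * bias k ^+ 2 = (2 * bias k) ^+ 2 by ring.
rewrite -(@real_normK _ (Delta p.1 - _)) ?num_real//.
have b0 := bias_ge0 k.
rewrite ler_sqr ?nnegrE ?mulr_ge0//.
have h1 : `|Delta p.1 - Delta t| <= bias k.
  by apply: le_bias; have [] := mem_window_index _ _ _ _ kt ps.
have h2 := window_mean_bias k kt.
by move: h1 h2; rewrite !ler_norml => /andP[? ?] /andP[? ?]; apply/andP; split; lra.
Qed.

(** On the flat list, [mu_hat] and the sum inside [v_hat] become [sample_mean] and [sample_sum_sqr],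
    so the one-window bounds apply with [L = ln (2 / delta')]. *)
Lemma psi_hat_event (delta' : R) (k : nat) : (1 <= k <= t)%N -> 1 <= ln (2 / delta') ->
  exists G : set Omega,
  [/\ measurable G, (P (~` G) <= (4 * expR (- ln (2 / delta')))%:E)%E &
  forall x, G x -> let u j i := f (z j i x) in
    `|mu_hat B u t k - window_mean k| <= psi_hat B u (2 * w) delta' t k /\
    psi_hat B u (2 * w) delta' t k <= ln (2 / delta') *
      (3 * (Num.sqrt (sigma2 k) / Num.sqrt (Bsum B t k)%:R) + 4 * bias k
       + 15 * (w / (Bsum B t k)%:R))].
Proof.
move=> kt L1; set L := ln (2 / delta').
have L0 : 0 < L by exact: lt_le_trans L1.
pose s := window_index B t k.
have [s0 es] := sample_index_split B t k kt.
have us := uniq_sample_index B t; rewrite es in us.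
have s_uniq : uniq s by move: us; rewrite cat_uniq => /and3P[].
pose X (p : nat * nat) := z p.1 p.2.
have mX p : p \in s -> measurable_fun setT (X p).
  by move=> /(mem_window_index _ _ _ _ kt)[? _ ?]; exact: z_measurable.
have lX p : p \in s -> forall A, measurable A -> P (X p @^-1` A) = Pj p.1 A.
  by move=> /(mem_window_index _ _ _ _ kt)[? _ ?]; exact: z_law.
have iX (A : nat * nat -> set Z) : (forall p, p \in s -> measurable (A p)) ->
    P (\big[setI/setT]_(p <- s) (X p @^-1` A p)) = (\prod_(p <- s) P (X p @^-1` A p))%E.
  move=> mA; have := z_indep; rewrite es => /(mutually_independent_suffix _ _ _ _ us).
  move=> /(_ (fun j i => A (j, i))) H.
  have eA p : A p = A (p.1, p.2) by case: p.
  under eq_bigr do rewrite eA.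
  under [RHS]eq_bigr do rewrite eA.
  by apply: H => p ps; rewrite -eA; exact: mA.
have s_gt0 : (0 < size s)%N by rewrite size_window_index Bsum_gt0.
have cm := window_mean_centered k kt.
have [G [mG PG HG]] := empirical_bernstein P _ X (fun p => Pj p.1) s s_uniq mX lX iX f w
  (window_mean k) w_gt0 f_measurable f_bounded s_gt0 cm L L0.
exists G; split => // x Gx u.
have [] := HG x Gx.
have muE : mu_hat B u t k = sample_mean _ X s f x.
  by rewrite /mu_hat /sample_mean size_window_index sum_window_index.
have vE : \sum_(t - k + 1 <= j < t.+1) \sum_(i < B j) (u j i - mu_hat B u t k) ^+ 2 =
    sample_sum_sqr _ X s f x.
  by rewrite /sample_sum_sqr sum_window_index muE.
rewrite /psi_hat /v_hat vE -muE size_window_index => dev SSb.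
have devw := deviation_le_range _ X (fun p => Pj p.1) s f w (window_mean k)
  f_measurable f_bounded s_gt0 cm x.
rewrite -muE in devw.
apply: (empirical_bernstein_radius_bounds _ (Bsum B t k) (sample_sum_sqr _ X s f x)
  (sigma2 k) (bias k) w L) => //.
- exact: Bsum_gt0.
- exact: bias_ge0.
- exact: sigma2_ge0.
- by apply: sumr_ge0 => p _; exact: sqr_ge0.
- by apply: (le_trans SSb); rewrite lerD2r ler_wpM2l// second_moment_le.
Qed.

(** A union bound over the [t] windows makes all radii valid at once; on that event Lepski's
    argument is deterministic and covers every admissible [khat]. *)
Lemma mu_hat_khat_event (delta' : R) : (1 <= t)%N -> 1 <= ln (2 / delta') ->
  exists G : set Omega,
  [/\ measurable G, (P (~` G) <= (t%:R * (4 * expR (- ln (2 / delta'))))%:E)%E &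
  forall x, G x -> let u j i := f (z j i x) in
    forall khat, is_khat B u (2 * w) delta' t khat ->
    forall k, (1 <= k <= t)%N ->
    `|mu_hat B u t khat - Delta t| <= 48 * ln (2 / delta') *
      (bias k + Num.sqrt (sigma2 k) / Num.sqrt (Bsum B t k)%:R + w / (Bsum B t k)%:R)].
Proof.
move=> t1 L1; set L := ln (2 / delta').
(* The range condition sits under the existential so that choice applies to all naturals; the union
   below runs over [k.+1] with [k < t]. *)
have /choice[G HG] : forall k, exists Gk : set Omega, (1 <= k <= t)%N -> 
  [/\ measurable Gk, (P (~` Gk) <= (4 * expR (- L))%:E)%E &
  forall x, Gk x -> let u j i := f (z j i x) in
    `|mu_hat B u t k - window_mean k| <= psi_hat B u (2 * w) delta' t k /\
    psi_hat B u (2 * w) delta' t k <= L *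
      (3 * (Num.sqrt (sigma2 k) / Num.sqrt (Bsum B t k)%:R) + 4 * bias k
       + 15 * (w / (Bsum B t k)%:R))].
  move=> k; have [kt|nkt] := boolP (1 <= k <= t)%N.
    by have [Gk H] := psi_hat_event delta' k kt L1; exists Gk.
  by exists setT.
have mG k : (k < t)%N -> measurable (~` G k.+1).
  by move=> kt; apply: measurableC; have [] := HG k.+1 kt.
have mU : measurable (\big[setU/set0]_(k < t) ~` G k.+1).
  by apply: bigsetU_measurable => k _; exact: mG.
exists (~` \big[setU/set0]_(k < t) ~` G k.+1); split.
- exact: measurableC.
- rewrite setCK; apply: (le_trans (@Boole_inequality _ _ _ P (fun k => ~` G k.+1) t mG)).
  have -> : t%:R * (4 * expR (- L)) = \sum_(k < t) (4 * expR (- L)) :> R.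
    by rewrite sumr_const card_ord mulr_natl.
  rewrite -sumEFin; apply: lee_sum => k _.
  by have [] := HG k.+1 (ltn_ord k).
move=> x nx u khat hk k kt.
have Gx i : (1 <= i <= t)%N -> G i x.
  case: i => // i it; apply: contrapT => ngx; apply: nx.
  by rewrite -(bigcup_mkord t (fun k => ~` G k.+1)); exists i.
have mu_psi i : (1 <= i <= t)%N -> `|mu_hat B u t i - window_mean i| <=
    psi_hat B u (2 * w) delta' t i.
  by move=> it; have [_ _ /(_ x (Gx i it))[]] := HG i it.
have psi_le : psi_hat B u (2 * w) delta' t k <= L *
      (3 * (Num.sqrt (sigma2 k) / Num.sqrt (Bsum B t k)%:R) + 4 * bias k
       + 15 * (w / (Bsum B t k)%:R)).
  by have [_ _ /(_ x (Gx k kt))[]] := HG k kt.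
have bm i j : (1 <= i)%N -> (i <= j)%N -> (j <= t)%N -> bias i <= bias j.
  by move=> _ ij _; exact: bias_mono.
have := is_khat_error_le B u (2 * w) delta' t window_mean bias (Delta t) mu_psi
  window_mean_bias bm khat k hk kt.
move/le_trans; apply.
(* Tripling [bias k] plus the radius bound gives coefficients 15, 9 and 45 for bias, deviation and
   range, all below 48; [1 <= L] puts the lone bias under the factor [L]. *)
have b0 := bias_ge0 k.
have h1 : bias k <= L * bias k by rewrite ler_peMl.
have L0 : 0 <= L by exact: le_trans L1.
have h2 : 0 <= L * (Num.sqrt (sigma2 k) / Num.sqrt (Bsum B t k)%:R).
  by rewrite mulr_ge0// divr_ge0 ?sqrtr_ge0.
have h3 : 0 <= L * (w / (Bsum B t k)%:R) by rewrite mulr_ge0// divr_ge0// ltW.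
lra.
Qed.

End rolling_window.

Theorem mainTheorem8 (R : realType) :
  exists C : R, 0 < C /\
  forall (dZ : measure_display) (Z : measurableType dZ)
         (Fm : Type) (ell : Fm -> Z -> R) (a b : R),
    a < b ->
    (forall f z, a <= ell f z <= b) ->
    (forall f, measurable_fun setT (ell f)) ->
  forall (Pj : nat -> probability Z R) (B : nat -> nat),
    (forall j, (1 <= B j)%N) ->
  forall (dO : measure_display) (Omega : measurableType dO)
         (P : probability Omega R) (z : nat -> nat -> Omega -> Z)
         (t : nat) (delta : R) (f1 f2 : Fm),
    (1 <= t)%N ->
    (forall j i, (1 <= j <= t)%N -> (i < B j)%N ->
       measurable_fun setT (z j i)) ->
    (forall j i, (1 <= j <= t)%N -> (i < B j)%N ->
       forall A, measurable A -> P (z j i @^-1` A) = Pj j A) ->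
    mutually_independent P z (sample_index B t) ->
    0 < delta < 1 ->
    let L j f := Ldist (Pj j) (ell f) in
    let Delta j := L j f1 - L j f2 in
    let sigma2 k := (Bsum B t k)%:R^-1 *
         \sum_(t - k + 1 <= j < t.+1)
            (B j)%:R * Vardist (Pj j) (fun x => ell f1 x - ell f2 x) in
    let delta' := delta / (3 * t%:R) in
    let M := 2 * (b - a) in
    exists E : set Omega, measurable E /\ (P E >= (1 - delta)%:E)%E /\
    forall w, E w ->
      let u j i := ell f1 (z j i w) - ell f2 (z j i w) in
      forall khat, is_khat B u M delta' t khat ->
        let fhat := if arw_choose_f1 B u t khat then f1 else f2 in
        L t fhat - Num.min (L t f1) (L t f2)
        <= C * ln (6 * t%:R / delta) *
           min_range (fun k =>
               max_window (fun j => `|Delta j - Delta t|) t k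
               + Num.sqrt (sigma2 k) / Num.sqrt (Bsum B t k)%:R
               + (b - a) / (Bsum B t k)%:R) t.
Proof.
exists 48; split=> //.
move=> dZ Z Fm ell a b ab ellab mell Pj B B0 dO Omega P z t delta f1 f2 t1 mz lz iz
  /andP[d0 d1] L Delta sigma2 delta' M.
(* The loss difference takes values in [-(b-a), b-a], so the half-range is [w = b - a] and
   [M = 2 * w]. *)
pose f y := ell f1 y - ell f2 y.
have w0 : 0 < b - a by rewrite subr_gt0.
have mf : measurable_fun setT f by exact: measurable_funB.
have bf y : `|f y| <= b - a.
  have /andP[? ?] := ellab f1 y; have /andP[? ?] := ellab f2 y.
  by rewrite /f ler_norml; apply/andP; split; lra.
have int_ell j g : (Pj j).-integrable setT (EFin \o ell g).
  apply: (@integrable_comp_bounded _ _ _ _ _ (`|a| + `|b|) (mell g) _ id (`|a| + `|b|)) => //.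
    move=> y; have /andP[h1 h2] := ellab g y.
    rewrite ler_norml; apply/andP; split.
      have := ler_norm (- a); rewrite normrN; have := normr_ge0 b; lra.
    by have := ler_norm b; have := normr_ge0 a; lra.
have DeltaE j : Delta j = Ldist (Pj j) f by exact/esym/(RintegralB measurableT (int_ell j f1) (int_ell j f2)).
have t0 : 0 < t%:R :> R by rewrite ltr0n.
have lnE : 2 / delta' = 6 * t%:R / delta.
  by rewrite /delta'; field; rewrite !gt_eqF.
have Lt : 6 <= 6 * t%:R / delta.
  rewrite ler_pdivlMr//; have : 1 <= t%:R :> R by rewrite ler1n.
  by lra.
(* [expR 1 <= 3] by [expR_le_affine], while [2 / delta'] is at least 6. *)
have L1 : 1 <= ln (2 / delta').
  rewrite lnE -[leLHS]expRK ler_ln ?posrE ?expR_gt0//; last exact: lt_le_trans Lt.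
  apply: le_trans Lt; apply: (le_trans (expR_le_affine 1 _)); lra.
have [G [mG PG HG]] := mu_hat_khat_event P Pj B z t f (b - a) B0 mz lz iz w0 mf bf delta' t1 L1.
exists G; split => //; split.
  have -> : P G = (1 - P (~` G))%E by rewrite -probability_setC ?setCK//; exact: measurableC.
  rewrite EFinB leeB//; apply: (le_trans PG); rewrite lee_fin expRN lnK; last first.
    by rewrite posrE lnE; exact: lt_le_trans Lt.
  rewrite lnE invf_div.
  (* Total failure probability: [t] windows, four events each, every event at most
     [delta / (6 * t)]. *)
  have -> : t%:R * (4 * (delta / (6 * t%:R))) = 2 / 3 * delta by field; rewrite gt_eqF.
  by lra.
move=> x Gx u khat hk; cbv zeta.
apply: le_mul_min_range => // k kt.
have := HG x Gx khat hk k kt; rewrite lnE -DeltaE.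
have -> : max_window (fun j => `|Ldist (Pj j) f - Delta t|) t k =
    max_window (fun j => `|Delta j - Delta t|) t k.
  by congr max_window; apply/funext => j; rewrite (DeltaE j).
apply: le_trans.
(* A correct choice has no excess. After a wrong one the estimate and [Delta t] lie on opposite
   sides of 0, so the excess [|Delta t|] is at most the estimation error. *)
rewrite /arw_choose_f1 /Delta; case: ifPn => [mu0|].
  have [_|_] := leP (L t f1) (L t f2); first by rewrite subrr normr_ge0.
  by rewrite distrC (le_trans _ (ler_norm _))//; lra.
rewrite -ltNge => mu0; have [_|_] := leP (L t f1) (L t f2); last by rewrite subrr normr_ge0.
by rewrite (le_trans _ (ler_norm _))//; lra.
Qed.
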